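(* Consider the multi-task linear model $Y_i^{(k)}=X_i^\top\beta^{(k)}+\varepsilon_i^{(k)}$, $1\le i\le N$, $0\le k\le K$, with the notation of the context, where $K=K_N$, $p=p_N$, $d=d_N$ and the model parameters may vary with $N$. Assume: (1) (Sub-Gaussian) The vectors $V_i=(X_i^\top,\varepsilon_i^\top)^\top\in\mathbb{R}^{p+K+1}$, $1\le i\le N$, are independent and identically distributed sub-Gaussian random vectors with $\|V_i\|_{\psi_2}=C_{\mathrm{sub}}<\infty$. (2) (Variance) There are two constants $\tau_{\min},\tau_{\max}$ such that $0<\tau_{\min}\le\lambda_{\min}(\Sigma_{xx})\le\lambda_{\max}(\Sigma_{xx})\le\tau_{\max}<\infty$ as $p\to\infty$ and $0<\tau_{\min}\le\lambda_{\min}(\Sigma_\varepsilon)\le\lambda_{\max}(\Sigma_\varepsilon)\le\tau_{\max}<\infty$ as $K\to\infty$. (3) (Regression coefficients) $\operatorname{rank}(B)=d<K+1$ and, for the same constants, $\tau_{\min}\le\lambda_d(B^\top B)\le\lambda_1(B^\top B)\le\tau_{\max}$ as $p\to\infty$. (4) (Divergence rate) As $N\to\infty$: $K\to\infty$, $p\to\infty$, $K/p\to0$ and $p/N\to0$. Then there exist constants $C_1$ and $C_2$ (not depending on $N$) and a sufficiently large constant $N_0$ such that, for every $N>N_0$, with probability at least $1-C_2\exp(-K)$, $$\big\|\widehat\beta_{\widehat w^*}-\widehat\beta_{w^*}\big\|_2\le C_1\left\{\sqrt{\frac{K+d}{N}}+\frac pN\right\}.$$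
   Context: Model. For $1\le i\le N$, $X_i\in\mathbb{R}^p$ is a random feature vector with $E(X_iX_i^\top)=\Sigma_{xx}\in\mathbb{R}^{p\times p}$. For $0\le k\le K$, $Y_i^{(k)}=X_i^\top\beta^{(k)}+\varepsilon_i^{(k)}$ with $\beta^{(k)}\in\mathbb{R}^p$ nonrandom; $k=0$ is the primary task and $k=1,\dots,K$ are auxiliary tasks. The noise vector $\varepsilon_i=(\varepsilon_i^{(0)},\dots,\varepsilon_i^{(K)})^\top\in\mathbb{R}^{K+1}$ is independent of $X_i$, with $E(\varepsilon_i)=0$ and $\operatorname{cov}(\varepsilon_i)=\Sigma_\varepsilon$. Put $B=(\beta^{(0)},\dots,\beta^{(K)})\in\mathbb{R}^{p\times(K+1)}$ and $d=\operatorname{rank}(B)$ (regarded as known when forming the estimators). OLS estimators. $\widehat\Sigma_{xx}=N^{-1}\sum_{i=1}^N X_iX_i^\top$, $\widehat\Sigma_{xy}^{(k)}=N^{-1}\sum_{i=1}^N Y_i^{(k)}X_i$, $\widehat\beta_{\mathrm{ols}}^{(k)}=\widehat\Sigma_{xx}^{-1}\widehat\Sigma_{xy}^{(k)}$ (when $\widehat\Sigma_{xx}$ is invertible), $\widehat B=(\widehat\beta_{\mathrm{ols}}^{(0)},\dots,\widehat\beta_{\mathrm{ols}}^{(K)})\in\mathbb{R}^{p\times(K+1)}$. The matrix $\widehat\Sigma_\varepsilon=(\widehat\sigma_{k_1,k_2})\in\mathbb{R}^{(K+1)\times(K+1)}$ has entries $\widehat\sigma_{k_1,k_2}=N^{-1}\sum_{i=1}^N(Y_i^{(k_1)}-X_i^\top\widehat\beta_{\mathrm{ols}}^{(k_1)})(Y_i^{(k_2)}-X_i^\top\widehat\beta_{\mathrm{ols}}^{(k_2)})$.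 Weights. Let $e_1=(1,0,\dots,0)^\top\in\mathbb{R}^{K+1}$. Let $\nu_1,\dots,\nu_{K+1}$ be orthonormal eigenvectors of $B^\top B$ for its eigenvalues in decreasing order, with sign normalized so that the entry of largest absolute value is positive, and $\Theta=(\nu_{d+1},\dots,\nu_{K+1})\in\mathbb{R}^{(K+1)\times(K-d+1)}$. Let $\widehat\nu_1,\dots,\widehat\nu_{K+1}$ be the orthonormal eigenvectors of $\widehat B^\top\widehat B$ for its eigenvalues in decreasing order, and $\widehat\Theta=(\widehat\nu_{d+1},\dots,\widehat\nu_{K+1})$. Define $$w^*=e_1-\Theta(\Theta^\top\Sigma_\varepsilon\Theta)^{-1}\Theta^\top\Sigma_\varepsilon e_1,\qquad \widehat w^*=e_1-\widehat\Theta(\widehat\Theta^\top\widehat\Sigma_\varepsilon\widehat\Theta)^{-1}\widehat\Theta^\top\widehat\Sigma_\varepsilon e_1 .$$ The oracle estimator is $\widehat\beta_{w^*}=\widehat Bw^*$ and the feasible estimator is $\widehat\beta_{\widehat w^*}=\widehat B\widehat w^*$. Norms. $\|u\|_2=(u^\top u)^{1/2}$. For a real random variable $U$, $\|U\|_{\psi_2}=\inf\{t>0:E\exp(U^2/t^2)\le2\}$; for a random vector $V$, $\|V\|_{\psi_2}=\sup_{\|u\|_2=1}\|u^\top V\|_{\psi_2}$, and $V$ is sub-Gaussian if this is finite. $\lambda_j(A)$ is the $j$-th largest eigenvalue of a symmetric matrix $A$. The quantities $C_{\mathrm{sub}},\tau_{\min},\tau_{\max}$ are constants not depending on $N,p,K,d$.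 *)

(* Defs.v *)
From HB Require Import structures.
From mathcomp Require Import all_boot all_order all_algebra.
From mathcomp Require Import all_classical all_reals all_analysis.

Set Implicit Arguments.
Unset Strict Implicit.
Unset Printing Implicit Defensive.

Import Order.TTheory GRing.Theory Num.Theory.
Import numFieldTopology.Exports numFieldNormedType.Exports.

Local Open Scope classical_set_scope.
Local Open Scope ring_scope.

(** * Linear algebra *)

Definition norm2 (R : realType) n (u : 'cV[R]_n) : R :=
  Num.sqrt ((u^T *m u) 0 0).

(** The choice below is unambiguous: a nonincreasing sequence with a given
    product of the [('X - a%:P)] is unique, and for a symmetric matrix it exists
    and has [n] terms.  The sequence is [[::]] when the characteristic polynomial
    does not split over [R]. *)
Definition eigvals (R : realType) n (A : 'M[R]_n) : seq R :=
  xget [::] [set s : seq R | sorted >=%R s /\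
                             char_poly A = \prod_(a <- s) ('X - a%:P)].

(** Numbered from 1: [eigval A 1] is the largest eigenvalue of [A : 'M_n] and
    [eigval A n] the smallest.  Not meant to be used at [j = 0]. *)
Definition eigval (R : realType) n (A : 'M[R]_n) (j : nat) : R :=
  (eigvals A)`_j.-1.

(** The columns of [nu] are orthonormal eigenvectors of [A], for its eigenvalues
    in nonincreasing order.  Such a [nu] is not unique. *)
Definition eigenbasis (R : realType) n (A nu : 'M[R]_n) : Prop :=
  nu^T *m nu = 1%:M /\
  exists2 lam : 'rV[R]_n,
    (forall i j : 'I_n, (i <= j)%N -> lam 0 j <= lam 0 i) &
    A *m nu = nu *m diag_mx lam.

(** If several entries are tied for the largest absolute value, one of them has
    to be positive. *)
Definition sign_normalized (R : realType) n (nu : 'M[R]_n) : Prop :=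
  forall j : 'I_n, exists2 i : 'I_n,
    (forall i', `|nu i' j| <= `|nu i j|) & 0 < nu i j.

(** The columns of 0-based index [d], ..., [K] of [nu], in this order. *)
Definition last_cols (R : realType) K (d : nat) (nu : 'M[R]_(K.+1)) :
    'M[R]_(K.+1, K.+1 - d) :=
  \matrix_(i, j) nu i (inord (d + j)).

Definition weights (R : realType) K m (Theta : 'M[R]_(K.+1, m))
    (S : 'M[R]_(K.+1)) : 'cV[R]_K.+1 :=
  let e1 := delta_mx ord0 ord0 : 'cV[R]_K.+1 in
  e1 - Theta *m invmx (Theta^T *m S *m Theta) *m Theta^T *m S *m e1.

(** * Least squares, as functions of the sample [x], [y] *)

Section Estimators.
Context {R : realType} {N p K : nat}.
Variables (x : 'I_N -> 'cV[R]_p) (y : 'I_N -> 'cV[R]_K.+1).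

Definition Sxx_hat : 'M[R]_p := N%:R^-1 *: \sum_(i < N) x i *m (x i)^T.

Definition Sxy_hat (k : 'I_K.+1) : 'cV[R]_p :=
  N%:R^-1 *: \sum_(i < N) y i k 0 *: x i.

Definition beta_ols (k : 'I_K.+1) : 'cV[R]_p := invmx Sxx_hat *m Sxy_hat k.

Definition B_hat : 'M[R]_(p, K.+1) := \matrix_(a, k) beta_ols k a 0.

Definition residual (i : 'I_N) (k : 'I_K.+1) : R :=
  y i k 0 - ((x i)^T *m beta_ols k) 0 0.

Definition Seps_hat : 'M[R]_(K.+1) :=
  \matrix_(k1, k2) (N%:R^-1 * \sum_(i < N) residual i k1 * residual i k2).

Definition beta_weighted (w : 'cV[R]_K.+1) : 'cV[R]_p := B_hat *m w.

End Estimators.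

(** * Random vectors *)

Definition borel_cV (R : realType) (n : nat) :=
  g_sigma_algebraType (@open 'cV[R]_n).

Section RandomVectors.
Context {d : measure_display} {T : measurableType d} {R : realType}.
Variable P : probability T R.

Definition random_vector n (V : T -> 'cV[R]_n) : Prop :=
  measurable_fun [set: T] (V : T -> borel_cV R n).

Definition mutually_independent (I : finType) n (V : I -> T -> 'cV[R]_n) : Prop :=
  forall (J : {set I}) (A : I -> set (borel_cV R n)),
    (forall i, measurable (A i)) ->
    P (\bigcap_(i in [set` J]) (V i @^-1` A i)) =
    (\prod_(i in J) P (V i @^-1` A i))%E.

Definition independent_pair m n (U : T -> 'cV[R]_m) (V : T -> 'cV[R]_n) : Prop :=
  forall (A : set (borel_cV R m)) (C : set (borel_cV R n)),
    measurable A -> measurable C ->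
    P (U @^-1` A `&` V @^-1` C) = (P (U @^-1` A) * P (V @^-1` C))%E.

Definition identically_distributed I n (V : I -> T -> 'cV[R]_n) : Prop :=
  forall (i j : I) (A : set (borel_cV R n)),
    measurable A -> P (V i @^-1` A) = P (V j @^-1` A).

(** [+oo] when no admissible [t] exists. *)
Definition psi2_norm (U : T -> R) : \bar R :=
  ereal_inf [set t%:E | t in [set t : R | 0 < t /\
    ('E_P[(fun w => expR (U w ^+ 2 / t ^+ 2))%R] <= 2%:E)%E]].

Definition psi2_vnorm n (V : T -> 'cV[R]_n) : \bar R :=
  ereal_sup [set psi2_norm (fun w => (u^T *m V w) 0 0) |
             u in [set u : 'cV[R]_n | norm2 u = 1]].

End RandomVectors.

(* Main.v *)
Require Import Defs.
From HB Require Import structures.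
From mathcomp Require Import all_boot all_order all_algebra.
From mathcomp Require Import all_classical all_reals all_analysis.
From mathcomp Require Import measurable_realfun zify ring lra.
Import Order.TTheory GRing.Theory Num.Theory.
Import numFieldTopology.Exports numFieldNormedType.Exports.

(** The weights [w = weights Theta Seps] minimize the variance [v^T Seps v] over
    the affine space [e1 + ker B], so that the oracle estimates [B e1] through
    [Bh w], where [Bh = B + E] and [E = Sxxhat^-1 G] with
    [G = N^-1 sum_i X_i eps_i^T].  The feasible weights solve the same problem with
    [ker B] replaced by the span [Qh] of the last right singular vectors of [Bh],
    and [Seps] by the residual covariance.  Both [E] and the error on [Seps] have
    operator norm of order [sqrt (p / N)], hence [p / N] is second order, and the
    point is that the first order term of [Bh (wh - w)] only involves [K + 2]
    dimensions instead of [p].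

    Deterministic part.  Let [z = e1 - w], a vector of [ker B], and let [y] be its
    component orthogonal to [Qh].  Then [wh - w = x + y] with [x] in [Qh].
    - [Bh] has norm at most [|E|] on [Qh] (Weyl), and [|x|] is of order [|E|] plus
      the error on [Seps], by comparing the stationarity conditions of the two
      problems; hence [Bh x] is of second order.
    - [Bh y] is orthogonal to [Bh] applied to [Qh], and [Bh z = E z], so that
      [|Bh y|^2 = (Bh y)^T E z = y^T B^T E z + (E y)^T E z], while [Bh] is bounded
      below on the complement of [Qh] (Weyl again), so that [|y|] is at most a
      constant times [|Bh y|].  Up to second order terms, [Bh y] is therefore
      bounded by [|B^T Sxx^-1 G z|], the norm of a vector of [K + 1] entries.
    This is [weights_perturbation], and [estimation_error] in terms of the sample.

    Probabilistic part.  For [V_i = (X_i, eps_i)], let [D] be the difference of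
    [N^-1 sum_i V_i V_i^T] and its expectation, the block diagonal matrix of [Sxx]
    and [Seps]; its off-diagonal block is [G].  All the random quantities are
    controlled by [D], of dimension [p + K + 1], and by [L D L^T], of dimension
    [K + 2], where [L] is block diagonal with blocks [B^T Sxx^-1] and [z^T]: one of
    its off-diagonal blocks is [B^T Sxx^-1 G z].  For any [L], the norm of
    [L D L^T] is of order [sqrt (m / N)], where [m] is its dimension, except with
    probability [2 exp (- m)] ([sample_moment_concentration]): a Chernoff bound for
    the sums of the sub-exponential variables [(u^T L V_i)^2], and a union bound
    over the points [u] of a grid of the unit ball of exponential size. *)

Set Implicit Arguments.
Unset Strict Implicit.
Unset Printing Implicit Defensive.

Local Open Scope classical_set_scope.
Local Open Scope ring_scope.

(** * Euclidean norm, operator bounds and coercive matrices *)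

Section Euclid.
Variable R : realType.
Implicit Types (m n : nat).

Definition dotv n (u v : 'cV[R]_n) : R := (u^T *m v) 0 0.

Lemma dotvE n (u v : 'cV[R]_n) : dotv u v = \sum_i u i 0 * v i 0.
Proof. by rewrite /dotv mxE; apply: eq_bigr => i _; rewrite mxE. Qed.

Lemma dotvC n (u v : 'cV[R]_n) : dotv u v = dotv v u.
Proof. by rewrite !dotvE; apply: eq_bigr => i _; rewrite mulrC. Qed.

Lemma dotvDr n (u v w : 'cV[R]_n) : dotv u (v + w) = dotv u v + dotv u w.
Proof. by rewrite /dotv mulmxDr mxE. Qed.

Lemma dotvDl n (u v w : 'cV[R]_n) : dotv (v + w) u = dotv v u + dotv w u.
Proof. by rewrite dotvC dotvDr !(dotvC u). Qed.

Lemma dotvZr n a (u v : 'cV[R]_n) : dotv u (a *: v) = a * dotv u v.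
Proof. by rewrite /dotv -scalemxAr mxE. Qed.

Lemma dotvZl n a (u v : 'cV[R]_n) : dotv (a *: u) v = a * dotv u v.
Proof. by rewrite dotvC dotvZr dotvC. Qed.

Lemma dotvNr n (u v : 'cV[R]_n) : dotv u (- v) = - dotv u v.
Proof. by rewrite -scaleN1r dotvZr mulN1r. Qed.

Lemma dotvNl n (u v : 'cV[R]_n) : dotv (- u) v = - dotv u v.
Proof. by rewrite dotvC dotvNr dotvC. Qed.

Lemma dotvBr n (u v w : 'cV[R]_n) : dotv u (v - w) = dotv u v - dotv u w.
Proof. by rewrite dotvDr dotvNr. Qed.

Lemma dotvBl n (u v w : 'cV[R]_n) : dotv (v - w) u = dotv v u - dotv w u.
Proof. by rewrite dotvDl dotvNl. Qed.

Lemma dotv0r n (u : 'cV[R]_n) : dotv u 0 = 0.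
Proof. by rewrite /dotv mulmx0 mxE. Qed.

Lemma dotv0l n (u : 'cV[R]_n) : dotv 0 u = 0.
Proof. by rewrite dotvC dotv0r. Qed.

Lemma dotv_mulmxr m n (A : 'M[R]_(m, n)) u v :
  dotv u (A *m v) = dotv (A^T *m u) v.
Proof. by rewrite /dotv trmx_mul trmxK mulmxA. Qed.

Lemma dotv_mulmxl m n (A : 'M[R]_(m, n)) u v :
  dotv (A *m v) u = dotv v (A^T *m u).
Proof. by rewrite dotvC dotv_mulmxr dotvC. Qed.

Lemma dotv_ge0 n (u : 'cV[R]_n) : 0 <= dotv u u.
Proof. by rewrite dotvE sumr_ge0// => i _; rewrite -expr2 sqr_ge0. Qed.

Lemma dotv_eq0 n (u : 'cV[R]_n) : (dotv u u == 0) = (u == 0).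
Proof.
apply/idP/eqP => [|->]; last by rewrite dotv0r.
rewrite dotvE psumr_eq0 => [|i _]; last by rewrite -expr2 sqr_ge0.
move=> /allP h; apply/matrixP => i j; rewrite ord1 mxE.
by have := h i; rewrite mem_index_enum -expr2 sqrf_eq0 => /(_ isT)/eqP.
Qed.

Lemma norm2_ge0 n (u : 'cV[R]_n) : 0 <= norm2 u.
Proof. exact: sqrtr_ge0. Qed.
Hint Resolve norm2_ge0 : core.

Lemma sqr_norm2 n (u : 'cV[R]_n) : norm2 u ^+ 2 = dotv u u.
Proof. by rewrite sqr_sqrtr// dotv_ge0. Qed.

Lemma norm2_eq0 n (u : 'cV[R]_n) : (norm2 u == 0) = (u == 0).
Proof. by rewrite -dotv_eq0 -sqr_norm2 sqrf_eq0. Qed.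

Lemma norm2_0 n : norm2 (0 : 'cV[R]_n) = 0.
Proof. by apply/eqP; rewrite norm2_eq0. Qed.

Lemma norm2_gt0 n (u : 'cV[R]_n) : (0 < norm2 u) = (u != 0).
Proof. by rewrite lt_def norm2_eq0 norm2_ge0 andbT. Qed.

Lemma norm2Z n a (u : 'cV[R]_n) : norm2 (a *: u) = `|a| * norm2 u.
Proof.
by rewrite /norm2 -/(dotv _ _) dotvZl dotvZr mulrA -expr2 sqrtrM ?sqr_ge0//
  sqrtr_sqr.
Qed.

Lemma norm2N n (u : 'cV[R]_n) : norm2 (- u) = norm2 u.
Proof. by rewrite -scaleN1r norm2Z normrN1 mul1r. Qed.

Lemma norm2_le n (u : 'cV[R]_n) c : 0 <= c -> dotv u u <= c ^+ 2 -> norm2 u <= c.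
Proof. by move=> c0 h; rewrite -(ler_sqr (norm2_ge0 u) c0) sqr_norm2. Qed.

Lemma cauchy_schwarz n (u v : 'cV[R]_n) : `|dotv u v| <= norm2 u * norm2 v.
Proof.
have h : dotv u v ^+ 2 <= dotv u u * dotv v v.
  have [->|v0] := eqVneq v 0; first by rewrite !dotv0r mulr0 expr0n.
  have vv : 0 < dotv v v by rewrite lt_def dotv_eq0 v0 dotv_ge0.
  have := dotv_ge0 (dotv v v *: u - dotv u v *: v).
  rewrite dotvBl !dotvBr !dotvZl !dotvZr (dotvC v u).
  set a := dotv v v in vv *; set b := dotv u v; set c := dotv u u => h.
  have : 0 <= a * (c * a - b ^+ 2) by nra.
  by rewrite pmulr_rge0// subr_ge0.
rewrite -ler_sqr ?nnegrE ?mulr_ge0// real_normK ?num_real//.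
by rewrite exprMn !sqr_norm2.
Qed.

Lemma dotv_le n (u v : 'cV[R]_n) : dotv u v <= norm2 u * norm2 v.
Proof. exact: le_trans (ler_norm _) (cauchy_schwarz u v). Qed.

Lemma norm2_delta n (i : 'I_n) : norm2 (delta_mx i 0 : 'cV[R]_n) = 1.
Proof.
apply/eqP; rewrite -(@eqrXn2 _ 2)// ?norm2_ge0// sqr_norm2 expr1n dotvE.
rewrite (bigD1 i)//= big1 => [|j ji]; first by rewrite !mxE !eqxx mul1r addr0.
by rewrite !mxE (negPf ji) mul0r.
Qed.

Lemma norm2D n (u v : 'cV[R]_n) : norm2 (u + v) <= norm2 u + norm2 v.
Proof.
apply: norm2_le; first exact: addr_ge0.
rewrite dotvDl !dotvDr (dotvC v u) sqrrD -!sqr_norm2.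
by have := dotv_le u v; lra.
Qed.

Lemma norm2B n (u v : 'cV[R]_n) : norm2 (u - v) <= norm2 u + norm2 v.
Proof. by rewrite -(norm2N v) norm2D. Qed.

(** A bound on the operator norm rather than the norm itself: no supremum is
    needed. *)
Definition opbound m n (A : 'M[R]_(m, n)) (c : R) : Prop :=
  forall u, norm2 (A *m u) <= c * norm2 u.

Lemma opbound_bilin m n (A : 'M[R]_(m, n)) c u v : opbound A c ->
  `|dotv u (A *m v)| <= c * (norm2 u * norm2 v).
Proof.
move=> h; apply: le_trans (cauchy_schwarz _ _) _.
by rewrite mulrCA ler_wpM2l.
Qed.

Lemma bilin_opbound m n (A : 'M[R]_(m, n)) c : 0 <= c ->
  (forall u v, dotv u (A *m v) <= c * (norm2 u * norm2 v)) -> opbound A c.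
Proof.
move=> c0 h v; have [->|] := eqVneq (norm2 (A *m v)) 0; first exact: mulr_ge0.
rewrite norm2_eq0 -norm2_gt0 => p; rewrite -(ler_pM2l p).
by have := h (A *m v) v; rewrite -sqr_norm2; lra.
Qed.

Lemma opbound_tr m n (A : 'M[R]_(m, n)) c : 0 <= c -> opbound A c ->
  opbound A^T c.
Proof.
move=> c0 h; apply: bilin_opbound => // u v.
rewrite -dotv_mulmxl; apply: le_trans (dotv_le _ _) _.
by rewrite mulrA ler_wpM2r.
Qed.

Lemma opboundD m n (A B : 'M[R]_(m, n)) a b :
  opbound A a -> opbound B b -> opbound (A + B) (a + b).
Proof.
move=> hA hB u; rewrite mulmxDl mulrDl.
exact: le_trans (norm2D _ _) (lerD (hA u) (hB u)).
Qed.

Lemma opboundN m n (A : 'M[R]_(m, n)) a : opbound A a -> opbound (- A) a.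
Proof. by move=> hA u; rewrite mulNmx norm2N. Qed.

Lemma opboundM m n k (A : 'M[R]_(m, n)) (B : 'M[R]_(n, k)) a b : 0 <= a ->
  opbound A a -> opbound B b -> opbound (A *m B) (a * b).
Proof.
move=> a0 hA hB u; rewrite -mulmxA -mulrA.
by apply: le_trans (hA _) _; rewrite ler_wpM2l.
Qed.

Lemma opbound_le m n (A : 'M[R]_(m, n)) a b : a <= b -> opbound A a -> opbound A b.
Proof. by move=> ab h u; apply: le_trans (h u) _; rewrite ler_wpM2r. Qed.

(** Polarization: the numerical radius of a symmetric matrix is its norm. *)
Lemma sym_opbound n (A : 'M[R]_n) c : 0 <= c -> A^T = A ->
  (forall u, `|dotv u (A *m u)| <= c * dotv u u) -> opbound A c.
Proof.
move=> c0 sA h; apply: bilin_opbound => // u v.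
have [->|u0] := eqVneq u 0; first by rewrite dotv0l norm2_0 mul0r mulr0.
have [->|v0] := eqVneq v 0; first by rewrite mulmx0 dotv0r norm2_0 !mulr0.
move: u0 v0; rewrite -!norm2_gt0 => u0 v0.
have := h (norm2 v *: u + norm2 u *: v); have := h (norm2 v *: u - norm2 u *: v).
rewrite mulmxBr mulmxDr -!scalemxAr !dotvBl !dotvBr !dotvDl !dotvDr.
rewrite !dotvZl !dotvZr -!sqr_norm2.
have -> : dotv v (A *m u) = dotv u (A *m v) by rewrite dotv_mulmxr sA dotvC.
rewrite (dotvC v u) !ler_norml => /andP[h1 _] /andP[_ h2].
have p : 0 < norm2 u * norm2 v by rewrite mulr_gt0.
rewrite -(ler_pM2l p); move: h1 h2.
set a := norm2 u; set b := norm2 v; set x := dotv u (A *m v).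
set y := dotv u v; set z := dotv u (A *m u); set t := dotv v (A *m v).
nra.
Qed.

Definition coercive n (A : 'M[R]_n) (c : R) : Prop :=
  forall u, c * dotv u u <= dotv u (A *m u).

Lemma coercive_unitmx n (A : 'M[R]_n) c : 0 < c -> coercive A c -> A \in unitmx.
Proof.
move=> c0 h; rewrite -unitmx_tr -row_free_unit; apply: inj_row_free => v vA.
apply: trmx_inj; rewrite trmx0; apply/eqP; rewrite -dotv_eq0.
have := h v^T; rewrite -[A]trmxK -trmx_mul vA trmx0 dotv0r pmulr_rle0//.
by move=> p; rewrite eq_le p dotv_ge0.
Qed.

Lemma coercive_invmx n (A : 'M[R]_n) c : 0 < c -> coercive A c ->
  opbound (invmx A) c^-1.
Proof.
move=> c0 h v; set u := invmx A *m v.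
have Au : A *m u = v by rewrite mulmxA mulmxV ?mul1mx// (coercive_unitmx c0 h).
rewrite ler_pdivlMl//; have [->|] := eqVneq (norm2 u) 0; first by rewrite mulr0.
rewrite norm2_eq0 -norm2_gt0 => p; rewrite -(ler_pM2l p).
by have := h u; rewrite Au -sqr_norm2; have := dotv_le u v; lra.
Qed.

End Euclid.

(* The wildcards match the order of [R] through any of its structures. *)
#[global] Hint Extern 0 (is_true (@Order.le _ _ _ _)) =>
  match goal with
  | |- is_true (@Order.le _ _ _ (@norm2 _ _ _)) => exact: norm2_ge0
  end : core.

(** * Eigenvalues of real symmetric matrices *)

Section Spectral.
Variable R : realType.

Lemma entry_le_norm2 n (u : 'cV[R]_n) i : `|u i 0| <= norm2 u.
Proof.
rewrite -(ler_sqr (normr_ge0 _) (norm2_ge0 _)) sqr_norm2 dotvE real_normK ?num_real// expr2.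
rewrite (bigD1 i)//= lerDl sumr_ge0// => j _.
by rewrite -expr2 sqr_ge0.
Qed.

Lemma opbound_exists m n (A : 'M[R]_(m, n)) : exists2 c, 0 <= c & opbound A c.
Proof.
exists (\sum_i \sum_j `|A i j|).
  by apply: sumr_ge0 => i _; apply: sumr_ge0.
apply: bilin_opbound => [|u v]; first by apply: sumr_ge0 => i _; apply: sumr_ge0.
rewrite dotvE mulr_suml; apply: ler_sum => i _.
rewrite mxE mulr_sumr mulr_suml; apply: ler_sum => j _.
apply: le_trans (ler_norm _) _; rewrite normrM normrM mulrCA.
by rewrite ler_wpM2l// ler_pM// entry_le_norm2.
Qed.

(** Expand the nonnegative form of [A] at the gradient step [u - c^-1 A u]. *)
Lemma psd_norm2_mulmx n (A : 'M[R]_n) c : A^T = A -> coercive A 0 ->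
  opbound A c -> 0 < c ->
  forall u, norm2 (A *m u) ^+ 2 <= c * dotv u (A *m u).
Proof.
move=> sA A0 Ac c0 u; have q v : 0 <= dotv v (A *m v).
  by have := A0 v; rewrite mul0r.
set v := A *m u.
have := q (u - c^-1 *: v).
have := opbound_bilin v v Ac.
have E : dotv u (A *m v) = norm2 v ^+ 2.
  by rewrite dotv_mulmxr sA sqr_norm2.
rewrite mulmxBr -scalemxAr dotvBl !dotvBr !dotvZl !dotvZr E -sqr_norm2 -/v.
have -> : dotv u v = dotv u (A *m u) by [].
rewrite ler_norml -expr2 => /andP[_ h] h2.
have {h} h : c^-1 * (c^-1 * dotv v (A *m v)) <= c^-1 * norm2 v ^+ 2.
  by rewrite ler_pM2l ?invr_gt0// ler_pdivrMl.
by rewrite -ler_pdivrMl//; lra.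
Qed.

(** Were the infimum [c] of the Rayleigh quotient not an eigenvalue, [A - c]
    would be positive semidefinite and invertible, hence bounded below by a
    positive constant. *)
Lemma rayleigh_min n (A : 'M[R]_n) : (0 < n)%N -> A^T = A ->
  exists2 c, eigenvalue A c & coercive A c.
Proof.
case: n A => // n A _ sA.
have [b b0 Ab] := opbound_exists A.
pose Q := [set dotv u (A *m u) | u in [set u : 'cV[R]_n.+1 | norm2 u = 1]].
have Q0 : Q !=set0.
  exists (dotv (delta_mx 0 0) (A *m delta_mx 0 0)).
  by exists (delta_mx 0 0) => //=; exact: norm2_delta.
have Qb : has_lbound Q.
  exists (- b) => _ [u /= u1 <-].
  by have := opbound_bilin u u Ab; rewrite u1 !mulr1 ler_norml => /andP[].
pose c := inf Q.
have Ac : coercive A c.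
  move=> u; have [->|] := eqVneq u 0; first by rewrite dotv0r dotv0l mulr0.
  rewrite -norm2_gt0 => u0.
  have : c <= dotv ((norm2 u)^-1 *: u) (A *m ((norm2 u)^-1 *: u)).
    apply: ge_inf => //; exists ((norm2 u)^-1 *: u) => //=.
    by rewrite norm2Z gtr0_norm ?invr_gt0// mulVf// gt_eqF.
  rewrite -scalemxAr dotvZl dotvZr -sqr_norm2 mulrA -invfM mulrC.
  by rewrite ler_pdivlMr ?mulr_gt0// expr2.
exists c => //.
case: (boolP (eigenvalue A c)) => // ev; exfalso.
pose S := A - c%:M.
have sS : S^T = S by rewrite /S linearB/= sA tr_scalar_mx.
have S0 : coercive S 0.
  move=> u; rewrite mul0r mulmxBl mul_scalar_mx dotvBr dotvZr subr_ge0.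
  exact: Ac.
have uS : S \in unitmx.
  rewrite -row_free_unit; apply: inj_row_free => v vS.
  apply/eqP; apply: contraNT ev => v0; apply/eigenvalueP; exists v => //.
  by move/eqP: vS; rewrite /S mulmxBr subr_eq0 mul_mx_scalar => /eqP.
have [s s0 Ss] := opbound_exists S.
have [t t0 St] := opbound_exists (invmx S).
have Ss' : opbound S (s + 1) by apply: opbound_le Ss; rewrite lerDl.
have St' : opbound (invmx S) (t + 1) by apply: opbound_le St; rewrite lerDl.
pose e := ((s + 1) * (t + 1) ^+ 2)^-1.
have e0 : 0 < e by rewrite invr_gt0 mulr_gt0// ?exprn_gt0//; lra.
have [|_ [u /= u1 <-]] := @inf_adherent _ Q e e0; first by split.
rewrite -/c -ltrBlDl.
have -> : dotv u (A *m u) - c = dotv u (S *m u).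
  by rewrite mulmxBl mul_scalar_mx dotvBr dotvZr -sqr_norm2 u1 expr1n mulr1.
apply/negP; rewrite -leNgt.
have s1 : 0 < s + 1 by lra.
have t1 : 0 < t + 1 by lra.
have := psd_norm2_mulmx sS S0 Ss' s1 u.
have := St' (S *m u); rewrite mulmxA mulVmx// mul1mx u1 => h1 h2.
rewrite /e -[leLHS]mul1r ler_pdivrMr ?mulr_gt0 ?exprn_gt0//.
have : 1 <= ((t + 1) * norm2 (S *m u)) ^+ 2 by rewrite exprn_ege1.
rewrite exprMn => h3; apply: le_trans h3 _.
have -> : dotv u (S *m u) * ((s + 1) * (t + 1) ^+ 2) =
          (t + 1) ^+ 2 * ((s + 1) * dotv u (S *m u)) by ring.
by rewrite ler_wpM2l ?sqr_ge0.
Qed.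

Lemma rayleigh_max n (A : 'M[R]_n) : (0 < n)%N -> A^T = A ->
  exists2 c, eigenvalue A c & forall u, dotv u (A *m u) <= c * dotv u u.
Proof.
move=> n0 sA; have [|c ec Ac] := @rayleigh_min n (- A) n0.
  by rewrite linearN/= sA.
exists (- c).
  case/eigenvalueP: ec => v vA v0; apply/eigenvalueP; exists v => //.
  by rewrite scaleNr -vA mulmxN opprK.
by move=> u; have := Ac u; rewrite mulNmx dotvNr; lra.
Qed.

Lemma eigvals_split n (A : 'M[R]_n) (s : seq R) : sorted >=%R s ->
  char_poly A = \prod_(a <- s) ('X - a%:P) -> eigvals A = s.
Proof.
move=> ss As; rewrite /eigvals; case: xgetP => [t _ [/= st At]|/(_ s)/= []//].
apply: (sorted_eq _ _ st ss).
- by move=> y x z xy yz; exact: le_trans yz xy.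
- by move=> x y /andP[xy yx]; apply/le_anti/andP; split.
- by apply: prod_XsubC_eq; rewrite -At.
Qed.

(** A positive lower bound on [eigval A n] rules out the default value of
    [eigvals], so that it does bound all eigenvalues. *)
Lemma eigval_bounds n (A : 'M[R]_n) a b : (0 < n)%N -> A^T = A -> 0 < a ->
  a <= eigval A n -> eigval A 1 <= b ->
  coercive A a /\ (forall u, dotv u (A *m u) <= b * dotv u u).
Proof.
move=> n0 sA a0; rewrite /eigval /eigvals.
case: xgetP => [s _ [/= ss As]|_]; last by rewrite nth_nil leNgt a0.
have sz : size s = n.
  by apply: succn_inj; rewrite -(size_char_poly A) As size_prod_XsubC.
have st : transitive (>=%R : rel R) by move=> y x z xy yz; exact: le_trans yz xy.
have rt c : eigenvalue A c -> c \in s.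
  by rewrite eigenvalue_root_char As root_prod_XsubC.
move=> h1 h2; split => u.
- have [c /rt cs Ac] := rayleigh_min n0 sA.
  apply: le_trans (Ac u); rewrite ler_wpM2r ?dotv_ge0//; apply: le_trans h1 _.
  rewrite -(nth_index 0 cs); apply: (sorted_leq_nth st _ _ ss) => //.
  + exact: lexx.
  + by rewrite inE index_mem.
  + by rewrite inE sz prednK.
  + by rewrite -ltnS prednK// -sz index_mem.
- have [c /rt cs Ac] := rayleigh_max n0 sA.
  apply: le_trans (Ac u) _; rewrite ler_wpM2r ?dotv_ge0//; apply: le_trans h2.
  rewrite -(nth_index 0 cs); apply: (sorted_leq_nth st _ _ ss) => //.
  + exact: lexx.
  + by rewrite inE sz.
  + by rewrite inE index_mem.
Qed.

Lemma eigenbasis_eigvals n (A nu : 'M[R]_n) (lam : 'rV[R]_n) :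
  nu^T *m nu = 1%:M ->
  (forall i j : 'I_n, (i <= j)%N -> lam 0 j <= lam 0 i) ->
  A *m nu = nu *m diag_mx lam ->
  eigvals A = [seq lam 0 i | i <- enum 'I_n].
Proof.
move=> nunu lams Anu; apply: eigvals_split.
  rewrite sorted_map; apply: (@sub_sorted _ (fun i j : 'I_n => (i <= j)%N)).
    by move=> i j /lams.
  by have := iota_sorted 0 n; rewrite -val_enum_ord sorted_map.
have -> : char_poly A = char_poly (diag_mx lam).
  pose P := map_mx polyC nu; have PP : P^T *m P = 1%:M.
    by rewrite matrix.map_trmx -map_mxM nunu map_mx1.
  have detP : \det P^T * \det P = 1 by rewrite -det_mulmx PP det1.
  rewrite /char_poly -[LHS]mulr1 -detP mulrCA -!det_mulmx; congr (\det _).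
  rewrite /char_poly_mx mulmxBl mulmxBr mul_scalar_mx -scalemxAr PP scalemx1.
  rewrite {1 2}/P matrix.map_trmx -!map_mxM -/P.
  by rewrite Anu mulmxA nunu mul1mx.
rewrite char_poly_trig ?diag_mx_is_trig// big_map big_enum.
by apply: eq_bigr => i _; rewrite mxE eqxx mulr1n.
Qed.

End Spectral.

(** * A grid of exponential size in the unit ball *)

Section Net.
Variable R : realType.

Lemma sum_half_le2 k : \sum_(j < k) (2^-1 : R) ^+ j <= 2.
Proof.
suff -> : \sum_(j < k) (2^-1 : R) ^+ j = 2 - 2 * 2^-1 ^+ k.
  by rewrite gerBl mulr_ge0// exprn_ge0.
elim: k => [|k IH]; first by rewrite big_ord0 expr0 mulr1 subrr.
by rewrite big_ord_recr/= IH exprS mulrA mulfV// mul1r; ring.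
Qed.

Section Grid.
Variable n : nat.
Let m := (4 * n)%N.

(** A sign and an absolute value for each coordinate. *)
Let code := {ffun 'I_n -> bool * 'I_m.+1}.

Definition mesh : R := (4 * Num.sqrt n%:R)^-1.

Definition grid_point (f : code) : 'cV[R]_n :=
  \col_i ((-1) ^+ (f i).1 * ((f i).2 : nat)%:R * mesh).

Definition grid_code (f : code) : bool :=
  (\sum_i ((f i).2 : nat) ^ 2 <= 16 * n)%N.

Definition grid : seq 'cV[R]_n := [seq grid_point f | f in grid_code].

(** Each admissible code [f] has [\sum_i (f i).2 <= 16 n], so it has weight at
    least 1 in the sum over all codes of [2 ^ (16 n - \sum_i (f i).2)]; that sum
    factors over the coordinates, as a product of geometric series. *)
Lemma size_grid : (size grid)%:R <= (2 ^+ 18) ^+ n :> R.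
Proof.
rewrite size_image -sum1_card natr_sum.
have wt f : grid_code f ->
    1 <= (2 ^+ 16) ^+ n * \prod_i (2^-1 : R) ^+ (f i).2.
  move=> hf; rewrite -exprM prodrXr.
  have le : (\sum_i (f i).2 <= 16 * n)%N.
    apply: leq_trans hf; apply: leq_sum => i _.
    by case: ((f i).2 : nat) => // k; rewrite -mulnn leq_pmulr.
  rewrite exprVn -ler_pdivrMr ?invr_gt0 ?exprn_gt0// invrK mul1r.
  by rewrite ler_weXn2l// ler1n.
apply: (@le_trans _ _ (\sum_(f : code) (2 ^+ 16) ^+ n * \prod_i (2^-1 : R) ^+ (f i).2)).
  rewrite [leRHS](bigID grid_code)/= -[leLHS]addr0 lerD//.
    by apply: ler_sum => f; exact: wt.
  apply: sumr_ge0 => f _; by rewrite mulr_ge0 ?exprn_ge0// prodr_ge0.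
rewrite -mulr_sumr -(bigA_distr_bigA (fun (i : 'I_n) (x : bool * 'I_m.+1) => (2^-1 : R) ^+ x.2)).
rewrite prodr_const card_ord -exprMn; apply: lerXn2r; rewrite ?nnegrE ?exprn_ge0//.
  by rewrite mulr_ge0 ?exprn_ge0// sumr_ge0// => x _; rewrite exprn_ge0.
have -> : (2 : R) ^+ 18 = 2 ^+ 16 * 2 ^+ 2 by rewrite -exprD.
rewrite ler_wpM2l ?exprn_ge0//.
rewrite -(pair_bigA _ (fun (b : bool) (j : 'I_m.+1) => (2^-1 : R) ^+ j))/= big_bool/=.
by have := sum_half_le2 m.+1; lra.
Qed.

Hypothesis n0 : (0 < n)%N.

Lemma sqr_mesh : mesh ^+ 2 = (16 * n%:R)^-1.
Proof.
by rewrite /mesh exprVn exprMn sqr_sqrtr// -natrX.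
Qed.

Lemma mesh_gt0 : 0 < mesh.
Proof. by rewrite invr_gt0 mulr_gt0// sqrtr_gt0 ltr0n. Qed.

Lemma norm2_grid u : u \in grid -> norm2 u <= 1.
Proof.
case/mapP => f; rewrite mem_enum => hf ->; apply: norm2_le => //.
rewrite dotvE expr1n.
under eq_bigr do rewrite mxE -expr2 !exprMn sqrr_sign mul1r -natrX sqr_mesh.
rewrite -mulr_suml -natr_sum ler_pdivrMr ?mulr_gt0 ?ltr0n// mul1r.
by rewrite -natrM ler_nat.
Qed.

(** Rounding every coordinate towards zero stays in the ball, and moves it by at
    most [mesh]. *)
Lemma grid_approx u : norm2 u <= 1 ->
  exists2 v, v \in grid & norm2 (u - v) <= 4^-1.
Proof.
move=> u1; have h0 := mesh_gt0.
pose j i := Num.truncn (`|u i 0| / mesh).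
have jP i : (j i)%:R * mesh <= `|u i 0| < (j i).+1%:R * mesh.
  have := @truncn_itv _ (`|u i 0| / mesh).
  by rewrite divr_ge0 ?(ltW h0)// => /(_ isT); rewrite ler_pdivlMr// ltr_pdivrMr.
have sj : (\sum_i j i ^ 2 <= 16 * n)%N.
  rewrite -(@ler_nat R) natr_sum.
  rewrite -(@ler_pM2r _ (mesh ^+ 2)) ?exprn_gt0// [in leRHS]sqr_mesh natrM.
  rewrite mulfV ?mulf_neq0 ?pnatr_eq0 -?lt0n//.
  apply: (@le_trans _ _ (norm2 u ^+ 2)); last by rewrite expr_le1// norm2_ge0.
  rewrite sqr_norm2 dotvE mulr_suml; apply: ler_sum => i _.
  have /andP[h _] := jP i; rewrite natrX -exprMn -expr2 -[leRHS]real_normK ?num_real//.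
  by rewrite ler_sqr ?nnegrE// mulr_ge0// (ltW h0).
have jm i : (j i < m.+1)%N.
  rewrite ltnS -(leq_exp2r _ _ (isT : 0 < 2)%N).
  apply: (@leq_trans (16 * n)).
    by apply: leq_trans sj; rewrite (bigD1 i)//= leq_addr.
  by rewrite /m expnMn leq_mul2l/= -mulnn leq_pmulr.
pose f : code := [ffun i => (u i 0 < 0, Ordinal (jm i))].
exists (grid_point f).
  apply/fintype.imageP; exists f => //.
  by rewrite unfold_in /grid_code; under eq_bigr do rewrite ffunE.
apply: norm2_le => //; rewrite dotvE.
apply: (@le_trans _ _ (\sum_(i < n) mesh ^+ 2)); last first.
  rewrite sumr_const card_ord sqr_mesh -[leLHS]mulr_natr invfM mulrAC -mulrA mulfV ?mulr1 ?pnatr_eq0 -?lt0n//.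
  by rewrite exprVn -natrX.
apply: ler_sum => i _; rewrite !mxE ffunE/= -expr2.
rewrite -[leLHS]real_normK ?num_real// ler_sqr ?nnegrE ?(ltW h0)//.
have /andP[h1 h2] := jP i; move: h1 h2; rewrite -natr1 mulrDl mul1r ler_norml.
have [ui|ui] := ltrP (u i 0) 0; rewrite ?expr1 ?expr0 ?mulN1r ?mul1r.
  by rewrite ltr0_norm// => h1 h2; apply/andP; split; lra.
by rewrite ger0_norm// => h1 h2; apply/andP; split; lra.
Qed.

End Grid.

(** With [a] the numerical radius of [A], moving from a point of the ball to a
    point of the grid at distance 1/4 changes the form by at most [a / 2]. *)
Lemma grid_quadratic n (A : 'M[R]_n) t : A^T = A -> 0 <= t ->
  (forall u, u \in grid n -> `|dotv u (A *m u)| <= t) ->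
  forall u, `|dotv u (A *m u)| <= 2 * t * dotv u u.
Proof.
case: n A => [|n] A sA t0 h u.
  by rewrite !dotvE !big_ord0 mulr0 normr0.
pose Q := [set `|dotv u (A *m u)| | u in [set u : 'cV[R]_n.+1 | norm2 u <= 1]].
have [b b0 Ab] := opbound_exists A.
have Q0 : Q !=set0.
  by exists `|dotv 0 (A *m 0)|, 0 => //=; rewrite norm2_0.
have Qb : has_ubound Q.
  exists b => _ [v /= v1 <-]; apply: le_trans (opbound_bilin v v Ab) _.
  rewrite -[leRHS]mulr1 ler_wpM2l// mulr_ile1 ?norm2_ge0//.
pose a := sup Q.
have Qa v : norm2 v <= 1 -> `|dotv v (A *m v)| <= a.
  by move=> v1; apply: ub_le_sup => //; exists v.
have a0 : 0 <= a by apply: le_trans (Qa 0 _); rewrite ?norm2_0.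
have qa v : `|dotv v (A *m v)| <= a * dotv v v.
  have [->|] := eqVneq v 0; first by rewrite !dotv0l normr0 mulr0.
  rewrite -norm2_gt0 => v0; have := Qa ((norm2 v)^-1 *: v).
  rewrite norm2Z gtr0_norm ?invr_gt0// mulVf ?gt_eqF// => /(_ (lexx _)).
  rewrite -scalemxAr dotvZl dotvZr mulrA normrM -invfM gtr0_norm ?invr_gt0 ?mulr_gt0//.
  by rewrite -sqr_norm2 mulrC ler_pdivrMr ?mulr_gt0// expr2.
have Aa : opbound A a by apply: sym_opbound.
suff a2 : a <= 2 * t by apply: le_trans (qa u) _; rewrite ler_wpM2r ?dotv_ge0.
suff : a <= t + a / 2 by lra.
apply: ge_sup => // _ [v /= v1 <-].
have [w wg vw] := grid_approx (ltn0Sn n) v1.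
have -> : dotv v (A *m v) = dotv w (A *m w) + dotv (v - w) (A *m (v + w)).
  rewrite mulmxDr dotvBl !dotvDr.
  have -> : dotv w (A *m v) = dotv v (A *m w) by rewrite dotv_mulmxr sA dotvC.
  by ring.
apply: le_trans (ler_normD _ _) _; apply: lerD; first exact: h.
apply: le_trans (opbound_bilin _ _ Aa) _; rewrite ler_wpM2l//.
have vw2 : norm2 (v + w) <= 2.
  apply: le_trans (norm2D _ _) _.
  by have := norm2_grid (ltn0Sn n) wg; lra.
have := norm2_ge0 (v - w); have := norm2_ge0 (v + w); nra.
Qed.

End Net.

(** * Rates *)

Section Rates.
Variable R : realType.

(** The bound of [sample_moment_concentration] on [L (S - M) L^T], of dimension
    [m], where [k] bounds the norm of [L]. *)
Definition deviation (k s : R) (m N : nat) : R :=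
  100 * k ^+ 2 * s ^+ 2 * Num.sqrt (m%:R / N%:R).

Lemma deviation_ge0 k s m N : 0 <= deviation k s m N.
Proof.
apply: mulr_ge0; last exact: sqrtr_ge0.
by apply: mulr_ge0; [apply: mulr_ge0 => //|]; exact: sqr_ge0.
Qed.

Lemma sqr_deviation_le s p K N : (p + K.+1 <= 2 * p)%N ->
  deviation 1 s (p + K.+1) N ^+ 2 <= 2 * 100 ^+ 2 * s ^+ 4 * (p%:R / N%:R).
Proof.
move=> pK; rewrite /deviation; set S := Num.sqrt _.
have -> : (100 * 1 ^+ 2 * s ^+ 2 * S) ^+ 2 = 100 ^+ 2 * s ^+ 4 * S ^+ 2 by ring.
have -> : 2 * 100 ^+ 2 * s ^+ 4 * (p%:R / N%:R) = 100 ^+ 2 * s ^+ 4 * ((2 * p)%:R / N%:R).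
  by rewrite natrM; ring.
rewrite sqr_sqrtr ?divr_ge0// ler_wpM2l//; first by rewrite mulr_ge0 ?exprn_even_ge0 ?sqr_ge0.
by rewrite ler_wpM2r ?invr_ge0// ler_nat.
Qed.

Lemma small_deviation (s t : R) : 0 < t -> exists2 e0 : R, 0 < e0 &
  forall N p K, (0 < N)%N -> (p + K.+1 <= 2 * p)%N -> p%:R / N%:R <= e0 ->
    [/\ (3 * (p + K.+1) <= N)%N, 4 * deviation 1 s (p + K.+1) N <= t &
        16 * deviation 1 s (p + K.+1) N ^+ 2 <= t ^+ 3].
Proof.
move=> t0; pose A := 2 * 100 ^+ 2 * s ^+ 4; pose tau := Num.min (t ^+ 2) (t ^+ 3).
have A0 : 0 <= A by apply: mulr_ge0; [rewrite mulr_ge0// sqr_ge0|exact: exprn_even_ge0].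
have A1 : 0 < 16 * (A + 1) by lra.
have tau0 : 0 < tau by rewrite lt_min !exprn_gt0.
exists (Num.min (1 / 6) (tau / (16 * (A + 1)))) => [|N p K N0 pK].
  by rewrite lt_min !divr_gt0.
rewrite le_min => /andP[pN6 pNt].
have NR0 : (0 : R) < N%:R by rewrite ltr0n.
have dl_tau : 16 * deviation 1 s (p + K.+1) N ^+ 2 <= tau.
  have := sqr_deviation_le s N pK; rewrite -/A => dl_sqr.
  have pN0 : 0 <= p%:R / N%:R :> R by rewrite divr_ge0.
  by move: pNt; rewrite ler_pdivlMr// => pNt; nra.
split.
- have : (6 * p <= N)%N.
    by rewrite -(ler_nat R) natrM; move: pN6; rewrite ler_pdivrMr//; lra.
  lia.
- rewrite -(ler_sqr (mulr_ge0 (ler0n _ 4) (deviation_ge0 _ _ _ _)) (ltW t0)) exprMn.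
  have -> : 4 ^+ 2 = 16 :> R by ring.
  by apply: le_trans dl_tau _; rewrite /tau ge_min lexx.
- by apply: le_trans dl_tau _; rewrite /tau ge_min lexx orbT.
Qed.

(** As [K < p], the squared deviation in dimension [p + K + 1] is of order [p / N],
    and the deviation in dimension [K + 2] is of order [sqrt (K / N)]. *)
Lemma rate_bound (C c k s : R) : exists2 C1 : R, 0 < C1 &
  forall N p K d, (0 < K)%N -> (p + K.+1 <= 2 * p)%N ->
    C * (deviation k s (K.+1 + 1) N + c * deviation 1 s (p + K.+1) N ^+ 2) <=
    C1 * (Num.sqrt ((K + d)%N%:R / N%:R) + p%:R / N%:R).
Proof.
pose a := 2 * 100 * k ^+ 2 * s ^+ 2; pose b := `|c| * (2 * 100 ^+ 2 * s ^+ 4).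
have a0 : 0 <= a by apply: mulr_ge0; [apply: mulr_ge0 => //|]; exact: sqr_ge0.
have b0 : 0 <= b.
  by apply: mulr_ge0 => //; apply: mulr_ge0; [rewrite mulr_ge0// sqr_ge0|exact: exprn_even_ge0].
exists (`|C| * (a + b) + 1); first by rewrite ltr_wpDl// mulr_ge0// addr_ge0.
move=> N p K d K0 pK.
set r1 := Num.sqrt ((K + d)%N%:R / N%:R); set r2 := p%:R / N%:R.
have r10 : 0 <= r1 by exact: sqrtr_ge0.
have r20 : 0 <= r2 by rewrite divr_ge0.
have h1 : deviation k s (K.+1 + 1) N <= a * r1.
  have -> : a * r1 = 100 * k ^+ 2 * s ^+ 2 * (2 * r1) by rewrite /a; ring.
  apply: ler_wpM2l.
    by apply: mulr_ge0; [apply: mulr_ge0 => //|]; exact: sqr_ge0.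
  have -> : 2 * r1 = Num.sqrt (2 ^+ 2 * ((K + d)%:R / N%:R)).
    by rewrite sqrtrM ?sqr_ge0// sqrtr_sqr ger0_norm.
  rewrite ler_wsqrtr// mulrA ler_wpM2r ?invr_ge0// -natrX -natrM ler_nat; lia.
have h2 : `|c * deviation 1 s (p + K.+1) N ^+ 2| <= b * r2.
  rewrite normrM [`|_ ^+ 2|]ger0_norm ?sqr_ge0// /b -mulrA ler_wpM2l//.
  exact: sqr_deviation_le.
apply: (@le_trans _ _ (`|C| * (a * r1 + b * r2))).
  apply: le_trans (ler_norm _) _; rewrite normrM ler_wpM2l//.
  apply: le_trans (ler_normD _ _) _; apply: lerD => //.
  by rewrite ger0_norm// deviation_ge0.
have h3 : a * r1 + b * r2 <= (a + b) * (r1 + r2) by nra.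
apply: le_trans (ler_wpM2l (normr_ge0 C) h3) _.
by rewrite mulrA mulrDl lerDl mul1r addr_ge0.
Qed.

Lemma dimensions_eventually (p K : nat -> nat) (e0 : R) : 0 < e0 ->
  K @ \oo --> \oo -> p @ \oo --> \oo ->
  ((K N)%:R / (p N)%:R : R) @[N --> \oo] --> (0 : R) ->
  ((p N)%:R / N%:R : R) @[N --> \oo] --> (0 : R) ->
  \forall N \near \oo, [/\ (0 < K N)%N, (0 < p N)%N,
    (p N + (K N).+1 <= 2 * p N)%N & (p N)%:R / N%:R <= e0].
Proof.
move=> e00 K_infty p_infty K_over_p p_over_N.
have hK : \forall N \near \oo, (0 < K N)%N := K_infty _ (nbhs_infty_gt 0).
have hp : \forall N \near \oo, (1 < p N)%N := p_infty _ (nbhs_infty_gt 1).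
have half0 : (0 : R) < 1 / 2 by lra.
have /cvgr0Pnorm_le/(_ _ half0) hKp := K_over_p.
have /cvgr0Pnorm_le/(_ _ e00) hpN := p_over_N.
near=> N.
have p1 : (1 < p N)%N by near: N.
have Kp : `|(K N)%:R / (p N)%:R| <= 1 / 2 :> R by near: N.
have pN : `|(p N)%:R / N%:R| <= e0 by near: N.
split.
- by near: N.
- exact: ltnW.
- have pR0 : (0 : R) < (p N)%:R by rewrite ltr0n ltnW.
  have : (2 * K N <= p N)%N.
    rewrite -(ler_nat R) natrM; have := le_trans (ler_norm _) Kp.
    by rewrite ler_pdivrMr//; clear; lra.
  by clear -p1; lia.
- exact: le_trans (ler_norm _) pN.
Unshelve. all: by end_near.
Qed.

End Rates.

(** * Integrals of products of independent variables *)

Section Independence.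
Context d (T : measurableType d) (R : realType) (P : probability T R).
Local Open Scope ereal_scope.

Import HBSimple HBNNSimple.

(** The class of [f] satisfying the conclusion contains the indicators, by
    hypothesis, and is closed under monotone limits. *)
Lemma weighted_integral d' (T' : measurableType d') (X : T -> T')
    (h : T -> R) (c : R) (f : T' -> R) :
  measurable_fun [set: T] X -> measurable_fun [set: T] h ->
  (forall x, 0 <= h x)%R ->
  (forall A, measurable A ->
     \int[P]_x (\1_A (X x) * h x)%:E = c%:E * P (X @^-1` A)) ->
  measurable_fun [set: T'] f -> (forall y, 0 <= f y)%R ->
  \int[P]_x (f (X x) * h x)%:E = c%:E * \int[P]_x (f (X x))%:E.
Proof.
move=> mX mh h0 hX mf f0.
have mf' : measurable_fun [set: T'] (EFin \o f) by exact/measurable_EFinP.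
pose g := nnsfun_approx measurableT mf'.
have mgX n : measurable_fun [set: T] (EFin \o g n \o X).
  by apply: measurableT_comp => //; exact/measurable_EFinP.
have cvg_g y : (EFin \o g n) y @[n --> \oo] --> (f y)%:E.
  have f0' x : [set: T'] x -> 0 <= (EFin \o f) x by move=> _; rewrite lee_fin.
  exact: (cvg_nnsfun_approx measurableT mf' f0' (I : [set: T'] y)).
have nd_g y : {homo (fun n => (EFin \o g n) y) : m n / (m <= n)%N >-> m <= n}.
  by move=> a b ab; rewrite lee_fin; exact/lefP/nd_nnsfun_approx.
have L1 : \int[P]_x ((EFin \o g n) (X x) * (h x)%:E) @[n --> \oo] -->
          \int[P]_x (f (X x) * h x)%:E.
  have fh x : (f (X x) * h x)%:E = lim ((EFin \o g n) (X x) * (h x)%:E @[n --> \oo]).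
    by apply/esym/cvg_lim => //; rewrite EFinM; apply: cvgeZr => //; exact: cvg_g.
  under eq_integral do rewrite fh.
  apply: cvg_monotone_convergence => //.
  - by move=> n; apply: emeasurable_funM; [exact: mgX|exact/measurable_EFinP].
  - by move=> n x _; rewrite mule_ge0// lee_fin.
  - move=> x _ a b ab; rewrite lee_wpmul2r ?lee_fin//; exact: nd_g.
have L2 : c%:E * \int[P]_x ((EFin \o g n) (X x)) @[n --> \oo] -->
          c%:E * \int[P]_x (f (X x))%:E.
  apply: cvgeZl => //.
  have fE x : (f (X x))%:E = lim ((EFin \o g n) (X x) @[n --> \oo]).
    by apply/esym/cvg_lim => //; exact: cvg_g.
  under eq_integral do rewrite fE.
  apply: cvg_monotone_convergence => //.
  by move=> n x _; rewrite lee_fin.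
apply: (cvg_unique _ L1); first exact: ereal_hausdorff.
apply: cvg_trans L2; apply: near_eq_cvg.
apply: nearW => n /=; apply: esym.
have m1 y : measurable_fun [set: T] (fun x => \1_(g n @^-1` [set y]) (X x) : R).
  by apply: measurableT_comp mX; exact: measurable_indic.
have gE x : g n (X x) =
    (\sum_(y \in range (g n)) (y * \1_(g n @^-1` [set y]) (X x)))%R.
  exact: fimfunE.
have fin : finite_set (range (g n)) by exact: fimfunP.
have ge0 y x : 0 <= (y * \1_(g n @^-1` [set y]) x)%:E by exact: nnfun_muleindic_ge0.
transitivity (\sum_(y \in range (g n))
    \int[P]_x ((y * \1_(g n @^-1` [set y]) (X x))%:E * (h x)%:E)).
  rewrite -ge0_integral_fsum//.
  - apply: eq_integral => x _.
    by rewrite -ge0_mule_fsuml// fsumEFin// -gE.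
  - move=> y; apply: emeasurable_funM; apply/measurable_EFinP => //.
    by apply: measurable_funM.
  - by move=> y x _; rewrite mule_ge0// lee_fin.
transitivity (c%:E * \sum_(y \in range (g n))
    \int[P]_x (y * \1_(g n @^-1` [set y]) (X x))%:E); last first.
  congr (_ * _); rewrite -ge0_integral_fsum//.
  - apply: eq_integral => x _.
    by rewrite fsumEFin// -gE.
  - by move=> y; apply/measurable_EFinP; apply: measurable_funM.
rewrite ge0_mule_fsumr; last by move=> y; apply: integral_ge0.
apply: eq_fsbigr => y /set_mem[z _ zy].
have y0 : (0 <= y)%R by rewrite -zy.
have mA : measurable (g n @^-1` [set y]) by exact: measurable_sfunP.
transitivity (y%:E * \int[P]_x (\1_(g n @^-1` [set y]) (X x) * h x)%:E).
  rewrite -ge0_integralZl//; last by move=> x _; rewrite lee_fin mulr_ge0.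
  - by apply: eq_integral => x _; rewrite -!EFinM mulrA.
  - by apply/measurable_EFinP; apply: measurable_funM.
rewrite hX// muleCA; congr (_ * _).
transitivity (\int[P]_x (y%:E * (\1_(X @^-1` (g n @^-1` [set y])) x)%:E)) => //.
have mXA : measurable (X @^-1` (g n @^-1` [set y])).
  by rewrite -[X @^-1` _]setTI; apply: mX.
rewrite ge0_integralZl//.
- by rewrite integral_indic// setIT.
- by apply/measurable_EFinP; exact: measurable_indic.
Qed.

(** Independence gives the case of indicators; the factors are then replaced one
    at a time, the product of all the others being the weight. *)
Lemma integral_prod_indep (I : finType) d' (T' : measurableType d')
    (V : I -> T -> T') (f : I -> T' -> R) (e : I -> R) :
  (forall i, measurable_fun [set: T] (V i)) ->
  (forall A : I -> set T', (forall i, measurable (A i)) ->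
     P (\bigcap_(i in [set: I]) (V i @^-1` A i)) = \prod_i P (V i @^-1` A i)) ->
  (forall i, measurable_fun [set: T'] (f i)) -> (forall i y, (0 <= f i y)%R) ->
  (forall i, \int[P]_x (f i (V i x))%:E = (e i)%:E) ->
  \int[P]_x (\prod_i f i (V i x))%:E = (\prod_i e i)%:E.
Proof.
move=> mV hV.
suff H (s : seq I) : forall (f : I -> T' -> R) (e : I -> R),
    (forall i, i \notin s -> exists2 A, measurable A & f i = \1_A) ->
    (forall i, measurable_fun [set: T'] (f i)) -> (forall i y, (0 <= f i y)%R) ->
    (forall i, \int[P]_x (f i (V i x))%:E = (e i)%:E) ->
    \int[P]_x (\prod_i f i (V i x))%:E = (\prod_i e i)%:E.
  by apply: (H (enum I)) => i; rewrite mem_enum.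
elim: s => [|k s IH] {}f {}e indf mf f0 fe.
  have /choice[A AP] i : exists A, measurable A /\ f i = \1_A.
    by have [//|A mA fA] := indf i; exists A.
  have mVA i : measurable (V i @^-1` A i).
    by rewrite -[X in measurable X]setTI; apply: mV => //; exact: (AP i).1.
  have PA i : P (V i @^-1` A i) = (e i)%:E.
    by rewrite -fe (AP i).2 -(setIT (_ @^-1` _)) -integral_indic.
  have -> : (\prod_i e i)%:E = \prod_i (e i)%:E by exact: (big_morph _ (@EFinM R)).
  rewrite -(eq_bigr _ (fun i _ => PA i)) -hV; last by move=> i; exact: (AP i).1.
  have mI : measurable (\bigcap_(i in [set: I]) (V i @^-1` A i)).
    by apply: fin_bigcap_measurable => //; exact: finite_finset.
  rewrite -[in RHS](setIT (\bigcap_(i in _) _)) -integral_indic//.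
  apply: eq_integral => x _; congr EFin; rewrite indicE.
  have [xV|xV] := boolP (x \in _).
    apply: big1 => i _; rewrite (AP i).2 indicE mem_set//.
    by move/set_mem: xV; apply.
  apply/eqP; rewrite prodf_seq_eq0; apply/hasP.
  have [i Vi] : exists i, ~ A i (V i x).
    apply/existsNP => h; move/negP: xV; apply; apply/mem_set => i _; exact: h.
  exists i; first by rewrite mem_index_enum.
  by rewrite /= (AP i).2 indicE memNset.
pose c := (\prod_(i | i != k) e i)%R.
pose h x := (\prod_(i | i != k) f i (V i x))%R.
have mh : measurable_fun [set: T] h.
  rewrite /h; under eq_fun do rewrite -big_filter.
  by apply: measurable_prod => i _; apply: measurableT_comp.
transitivity (\int[P]_x (f k (V k x) * h x)%:E).
  by apply: eq_integral => x _; rewrite (bigD1 k).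
rewrite (weighted_integral (c := c))//.
- by rewrite fe -EFinM mulrC [in RHS](bigD1 k).
- by move=> x; apply: prodr_ge0.
move=> A mA.
have mVA : measurable (V k @^-1` A).
  by rewrite -[X in measurable X]setTI; apply: mV.
pose f' i := if i == k then \1_A else f i.
pose e' i := if i == k then fine (P (V k @^-1` A)) else e i.
have := IH f' e'; rewrite (bigD1 k)//=.
have -> : (\prod_(i | i != k) e' i = c)%R.
  by apply: eq_bigr => i ik; rewrite /e' (negPf ik).
have -> : e' k = fine (P (V k @^-1` A)) by rewrite /e' eqxx.
rewrite EFinM fineK ?fin_num_measure// muleC => <-.
- apply: eq_integral => x _; rewrite (bigD1 k)//= /f' eqxx; congr (_ * _)%:E.
  by apply: eq_bigr => i ik; rewrite (negPf ik).
- move=> i is_; rewrite /f'; case: eqVneq => [_|ik]; first by exists A.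
  by apply: indf; rewrite inE negb_or ik.
- by move=> i; rewrite /f'; case: eqVneq.
- by move=> i y; rewrite /f'; case: eqVneq.
- move=> i; rewrite /f' /e'; case: eqVneq => [->|_] //.
  by rewrite fineK ?fin_num_measure// -[in RHS](setIT (_ @^-1` _)) -integral_indic.
Qed.

End Independence.

(** * Chernoff bound for sums of sub-exponential variables *)

Section Chernoff.
Context d (T : measurableType d) (R : realType) (P : probability T R).

Lemma expR_quadratic_ub (x : R) : expR x <= 1 + x + x ^+ 2 * expR `|x|.
Proof.
have h1 : expR x - 1 <= x * expR x.
  have := expR_ge1Dx (- x); rewrite expRN => h.
  have e0 := expR_gt0 x.
  have : expR x * (1 - x) <= expR x * (expR x)^-1 by rewrite ler_pM2l.
  by rewrite mulfV ?gt_eqF//; lra.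
have h2 := expR_ge1Dx x.
have [x0|x0] := leP 0 x.
  by rewrite ger0_norm//; nra.
have : 1 <= expR `|x| by rewrite -[1]expR0 ler_expR normr_ge0.
by have := sqr_ge0 x; nra.
Qed.

Lemma expR_scaled_ub (l q : R) : 0 <= q -> `|l| <= 2^-1 ->
  expR (l * q) <= 1 + l * q + 16 * l ^+ 2 * expR q.
Proof.
move=> q0 l2; apply: le_trans (expR_quadratic_ub _) _.
rewrite lerD2l exprMn normrM (ger0_norm q0).
have h4 : q ^+ 2 <= 16 * expR (q / 2).
  have -> : q / 2 = q / 4 + q / 4 by field.
  by rewrite expRD; have := expR_ge1Dx (q / 4); nra.
have key : q ^+ 2 * expR (`|l| * q) <= 16 * expR q.
  have -> : 16 * expR q = 16 * expR (q / 2) * expR (q / 2).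
    by rewrite -mulrA -expRD -splitr.
  apply: ler_pM; rewrite ?sqr_ge0 ?expR_ge0//.
  by rewrite ler_expR mulrC ler_wpM2l.
by have := ler_wpM2l (sqr_ge0 l) key; lra.
Qed.

Lemma le_integral_real (f g : T -> R) : measurable_fun [set: T] f ->
  measurable_fun [set: T] g -> (forall x, 0 <= f x) -> (forall x, f x <= g x) ->
  (\int[P]_x (f x)%:E <= \int[P]_x (g x)%:E)%E.
Proof.
move=> mf mg f0 fg; apply: ge0_le_integral => //.
- by move=> x _; rewrite lee_fin.
- exact/measurable_EFinP.
- exact/measurable_EFinP.
- by move=> x _; rewrite lee_fin.
Qed.

Lemma integrable_real_lty (f : T -> R) : measurable_fun [set: T] f ->
  (\int[P]_x (`|f x|)%:E < +oo)%E -> P.-integrable [set: T] (EFin \o f).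
Proof.
by move=> mf fi; apply/integrableP; split; first exact/measurable_EFinP.
Qed.

(** Bernstein's condition: [expR_scaled_ub] is integrated, with [2] as a bound on
    the expectation of [expR q]. *)
Lemma mgf_subexponential (q : T -> R) (m l : R) : measurable_fun [set: T] q ->
  (forall x, 0 <= q x) -> (\int[P]_x (expR (q x))%:E <= 2%:E)%E ->
  (\int[P]_x (q x)%:E = m%:E)%E -> `|l| <= 2^-1 ->
  exists2 e : R, (\int[P]_x (expR (l * q x))%:E = e%:E)%E &
                 0 <= e <= expR (l * m + 32 * l ^+ 2).
Proof.
move=> mq q0 q2 qm l2.
have me : measurable_fun [set: T] (fun x => expR (q x)) by apply: measurableT_comp.
have ml : measurable_fun [set: T] (fun x => expR (l * q x)).
  by apply: measurableT_comp => //; exact: measurable_funM.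
have ie : P.-integrable [set: T] (EFin \o (fun x => expR (q x))).
  apply: integrable_real_lty => //; under eq_integral do rewrite ger0_norm ?expR_ge0//.
  exact: le_lt_trans q2 (ltry _).
have iq : P.-integrable [set: T] (EFin \o q).
  apply: integrable_real_lty => //; under eq_integral do rewrite ger0_norm//.
  by rewrite qm ltry.
have ub : (\int[P]_x (expR (l * q x))%:E <=
           (1 + l * m + 16 * l ^+ 2 * 2)%:E)%E.
  apply: (@le_trans _ _ (\int[P]_x (1 + l * q x + 16 * l ^+ 2 * expR (q x))%:E)%E).
    apply: le_integral_real => //.
    - by apply: measurable_funD; [apply: measurable_funD => //|]; apply: measurable_funM.
    - by move=> x; exact: expR_scaled_ub.
  have i1 : P.-integrable [set: T] (fun x => (l%:E * (q x)%:E)%E).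
    exact: integrableZl.
  have i2 : P.-integrable [set: T] (fun x => ((16 * l ^+ 2)%:E * (expR (q x))%:E)%E).
    exact: integrableZl.
  have i3 : P.-integrable [set: T] (fun x : T => 1%:E).
    exact: finite_measure_integrable_cst.
  have -> : (\int[P]_x (1 + l * q x + 16 * l ^+ 2 * expR (q x))%:E =
      \int[P]_x ((1%:E + l%:E * (q x)%:E) + (16 * l ^+ 2)%:E * (expR (q x))%:E))%E.
    by [].
  rewrite integralD//; last exact: integrableD.
  rewrite integralD//.
  rewrite [X in (X + _ + _)%E](_ : _ = 1%E); last first.
    by rewrite integral_cst// mul1e; exact: probability_setT.
  rewrite !integralZl// qm EFinD leeD//.
  by rewrite [leRHS]EFinM lee_wpmul2l// lee_fin mulr_ge0// sqr_ge0.
exists (fine (\int[P]_x (expR (l * q x))%:E)%E).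
  rewrite fineK// ge0_fin_numE; first exact: le_lt_trans ub (ltry _).
  by apply: integral_ge0 => x _; rewrite lee_fin expR_ge0.
rewrite fine_ge0/=; last by apply: integral_ge0 => x _; rewrite lee_fin expR_ge0.
apply: le_trans (_ : 1 + (l * m + 32 * l ^+ 2) <= _); last exact: expR_ge1Dx.
rewrite -lee_fin fineK; last first.
  rewrite ge0_fin_numE; first exact: le_lt_trans ub (ltry _).
  by apply: integral_ge0 => x _; rewrite lee_fin expR_ge0.
by apply: le_trans ub _; rewrite lee_fin; lra.
Qed.

Lemma measurable_superlevel (g : T -> R) (c : R) :
  measurable_fun [set: T] g -> measurable [set x | c <= g x].
Proof.
move=> mg; have -> : [set x | c <= g x] = [set: T] `&` g @^-1` `[c, +oo[%classic.
  by rewrite setTI; apply/seteqP; split=> x /=; rewrite in_itv/= andbT.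
exact: mg.
Qed.

Section IndependentSum.
Context d' (T' : measurableType d') (N : nat) (V : 'I_N -> T -> T').
Variables (q : T' -> R) (m : R).
Hypothesis mV : forall i, measurable_fun [set: T] (V i).
Hypothesis hV : forall A : 'I_N -> set T', (forall i, measurable (A i)) ->
  (P (\bigcap_(i in [set: 'I_N]) (V i @^-1` A i)) = \prod_i P (V i @^-1` A i))%E.
Hypothesis mq : measurable_fun [set: T'] q.
Hypothesis q0 : forall y, 0 <= q y.
Hypothesis q2 : forall i, (\int[P]_x (expR (q (V i x)))%:E <= 2%:E)%E.
Hypothesis qm : forall i, (\int[P]_x (q (V i x))%:E = m%:E)%E.

Let dev x := \sum_i q (V i x) - N%:R * m.

Let mdev : measurable_fun [set: T] dev.
Proof.
apply: measurable_funB => //; apply: measurable_sum => i.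
exact: measurableT_comp.
Qed.

(* [t / 64] minimizes [- l t + 32 l ^ 2]; the sign of [l] selects the tail. *)
Let chernoff_side (l t : R) : `|l| = t / 64 -> 0 <= t <= 32 ->
  (P [set x | (N%:R * t * `|l| <= l * dev x)%R] <= (expR (- (N%:R * t ^+ 2 / 128)))%:E)%E.
Proof.
move=> lt /andP[t0 t32].
have l2 : `|l| <= 2^-1 by rewrite lt; lra.
have mq' i : measurable_fun [set: T] (q \o V i) by apply: measurableT_comp.
have /choice[e eP] i : exists e, (\int[P]_x (expR (l * q (V i x)))%:E = e%:E)%E /\
    0 <= e <= expR (l * m + 32 * l ^+ 2).
  by have [e e1 e2] := @mgf_subexponential (q \o V i) m l (mq' i) (fun x => q0 _) (q2 i) (qm i) l2; exists e.
pose c := expR (- (l * (N%:R * m)) - N%:R * t * `|l|).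
have mA := measurable_superlevel (N%:R * t * `|l|)
  (measurable_funM (@measurable_cst _ _ T R setT l) mdev).
set A := [set x | _] in mA *.
have mprod : measurable_fun [set: T] (fun x => \prod_i expR (l * q (V i x))).
  apply: measurable_prod => i _; apply: measurableT_comp => //.
  by apply: measurable_funM => //; exact: mq'.
have prod0 x : 0 <= \prod_i expR (l * q (V i x)).
  by apply: prodr_ge0 => i _; exact: expR_ge0.
apply: (@le_trans _ _ (\int[P]_x (c * \prod_i expR (l * q (V i x)))%:E)%E).
  rewrite -[X in (P X)]setIT -integral_indic//; apply: le_integral_real => //.
  - exact: measurable_funM.
  - move=> x; rewrite indicE; have [|_] := boolP (x \in A); last first.
      by rewrite mulr_ge0// expR_ge0.
    move/set_mem => /= h; rewrite -expR_sum -expRD -mulr_sumr leNgt expR_lt1 -leNgt.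
    by move: h; rewrite /A/= /dev; lra.
have -> : (\int[P]_x (c * \prod_i expR (l * q (V i x)))%:E =
           (c * \prod_i e i)%:E)%E.
  under eq_integral do rewrite EFinM.
  rewrite ge0_integralZl//.
  - rewrite EFinM; congr (_ * _)%E.
    apply: (@integral_prod_indep _ _ _ P _ _ _ V (fun _ y => expR (l * q y))) => //.
    + by move=> _; apply: measurableT_comp => //; exact: measurable_funM.
    + by move=> i; exact: (eP i).1.
  - exact/measurable_EFinP.
  - by move=> x _; rewrite lee_fin.
  - by rewrite lee_fin expR_ge0.
rewrite lee_fin; apply: le_trans (_ : c * \prod_(i < N) expR (l * m + 32 * l ^+ 2) <= _).
  rewrite ler_wpM2l ?expR_ge0//; apply: ler_prod => i _; exact: (eP i).2.
rewrite prodr_const card_ord -expRM_natl -expRD ler_expR.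
have -> : l ^+ 2 = `|l| ^+ 2 by rewrite real_normK ?num_real.
by rewrite lt mulr_natl; lra.
Qed.

Lemma chernoff_deviation (t : R) : 0 <= t <= 32 ->
  (P [set x | (N%:R * t <= `|dev x|)%R] <=
   (2 * expR (- (N%:R * t ^+ 2 / 128)))%:E)%E.
Proof.
move=> t032; have /andP[t0 t32] := t032.
have t64 : `|t / 64| = t / 64 by rewrite ger0_norm// divr_ge0.
have t64N : `|- (t / 64)| = t / 64 by rewrite normrN.
have mA l := measurable_superlevel (N%:R * t * `|l|)
  (measurable_funM (@measurable_cst _ _ T R setT l) mdev).
have := leeD (chernoff_side t64 t032) (chernoff_side t64N t032).
rewrite -EFinD -mulr2n -[X in (_ <= X%:E)%E]mulr_natl => h.
apply: le_trans h; apply: le_trans; last exact: measureU2 (mA _) (mA _).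
apply: le_measure; rewrite ?inE; [|exact: measurableU|].
  by apply: measurable_superlevel; apply: measurableT_comp.
move=> x /= h; have [d0|d0] := leP 0 (dev x).
  left; rewrite t64; move: h; rewrite ger0_norm// => h.
  by rewrite mulrC ler_wpM2l// divr_ge0.
right; rewrite t64N; move: h; rewrite ltr0_norm// => h.
by rewrite mulNr -mulrN mulrC ler_wpM2l// divr_ge0.
Qed.

End IndependentSum.

End Chernoff.

(** * Moments of sub-Gaussian vectors *)

Section BorelVectors.
Variable R : realType.

Lemma measurable_coord n (i : 'I_n) :
  measurable_fun [set: borel_cV R n] (fun y : borel_cV R n => (y : 'cV[R]_n) i 0).
Proof.
apply: (measurability _ (RGenOInfty.measurableE R)).
move=> _ [_ [a ->] <-]; rewrite setTI; apply: sub_sigma_algebra => /=.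
apply: (@open_comp _ _ (fun y : 'cV[R]_n => y i 0)); last exact: interval_open.
by move=> y _; exact: coord_continuous.
Qed.

Lemma measurable_dotv n (v : 'cV[R]_n) :
  measurable_fun [set: borel_cV R n] (fun y : borel_cV R n => dotv v (y : 'cV[R]_n)).
Proof.
under eq_fun do rewrite dotvE.
apply: measurable_sum => i.
by apply: measurable_funM => //; exact: measurable_coord.
Qed.

End BorelVectors.

Section SubGaussian.
Context d (T : measurableType d) (R : realType) (P : probability T R).

(** What [psi2_vnorm P V < s] gives, without infimum or supremum.  The unit ball
    replaces the sphere because the points of the grid lie in the ball. *)
Definition subgaussian n (V : T -> 'cV[R]_n) (s : R) : Prop :=
  forall u, norm2 u <= 1 ->
    (\int[P]_x (expR (dotv u (V x) ^+ 2 / s ^+ 2))%:E <= 2%:E)%E.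

Lemma measurable_dotv_rv n (V : T -> 'cV[R]_n) u : random_vector V ->
  measurable_fun [set: T] (fun x => dotv u (V x)).
Proof.
by move=> mV; apply: (measurableT_comp (@measurable_dotv R n u)).
Qed.

(** The infimum that defines [psi2_norm] may not be attained, but some admissible
    [t] lies below [C + 1]. *)
Lemma psi2_subgaussian n (V : T -> 'cV[R]_n) (C : R) : (0 < n)%N ->
  random_vector V -> psi2_vnorm P V = C%:E -> 0 < C + 1 /\ subgaussian V (C + 1).
Proof.
move=> n0 mV VC.
have H u : norm2 u = 1 -> exists t : R, [/\ 0 < t, t < C + 1 &
    (\int[P]_x (expR (dotv u (V x) ^+ 2 / t ^+ 2))%:E <= 2%:E)%E].
  move=> u1.
  have /ereal_inf_lt[_ [t [t0 ht] <-] tC] :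
      (psi2_norm P (fun w => ((u^T *m V w) 0 0)%R) < (C + 1)%:E)%E.
    apply: (@le_lt_trans _ _ C%:E); last by rewrite lte_fin ltrDl.
    by rewrite -VC; apply: ereal_sup_ubound; exists u.
  by exists t; split => //; move: ht; rewrite unlock.
have s0 : 0 < C + 1.
  have [t [t0 tC _]] := H (delta_mx (Ordinal n0) 0) (norm2_delta R (Ordinal n0)).
  exact: lt_trans tC.
split=> // u u1.
have mexp (v : 'cV[R]_n) t : measurable_fun [set: T] (fun x => expR (dotv v (V x) ^+ 2 / t ^+ 2)).
  apply: measurableT_comp => //; apply: measurable_funM => //.
  by apply: measurable_funX; exact: measurable_dotv_rv.
have [->|] := eqVneq u 0.
  under eq_integral do rewrite dotv0l expr0n mul0r expR0.
  have := expectation_cst P 1; rewrite unlock => ->.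
  by rewrite lee_fin ler1n.
rewrite -norm2_gt0 => u0.
have [|t [t0 tC ht]] := H ((norm2 u)^-1 *: u).
  by rewrite norm2Z gtr0_norm ?invr_gt0// mulVf// gt_eqF.
apply: le_trans ht; apply: le_integral_real => // x.
rewrite ler_expR dotvZl exprMn ler_pM ?sqr_ge0 ?invr_ge0 ?sqr_ge0//.
  rewrite -[leLHS]mul1r ler_wpM2r ?sqr_ge0// exprVn invf_ge1 ?exprn_gt0//.
  by rewrite expr_le1// norm2_ge0.
rewrite lef_pV2 ?posrE ?exprn_gt0// ler_sqr ?nnegrE ?ltW//.
Qed.

Section Moments.
Variables (n : nat) (V : T -> 'cV[R]_n) (s : R).
Hypotheses (mV : random_vector V) (s0 : 0 < s) (Vs : subgaussian V s).

Lemma integrable_sqr_dotv u : norm2 u <= 1 ->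
  P.-integrable [set: T] (EFin \o (fun x => dotv u (V x) ^+ 2)).
Proof.
move=> u1; apply: integrable_real_lty.
  by apply: measurable_funX; exact: measurable_dotv_rv.
apply: (@le_lt_trans _ _ (\int[P]_x (s ^+ 2 * expR (dotv u (V x) ^+ 2 / s ^+ 2))%:E)%E).
  apply: le_integral_real => [||//|x].
  - apply: measurableT_comp => //; apply: measurable_funX; exact: measurable_dotv_rv.
  - apply: measurable_funM => //; apply: measurableT_comp => //.
    apply: measurable_funM => //; apply: measurable_funX; exact: measurable_dotv_rv.
  - rewrite ger0_norm ?sqr_ge0// mulrC -ler_pdivrMr ?exprn_gt0//.
    by apply: le_trans (expR_ge1Dx _); lra.
under eq_integral do rewrite EFinM.
rewrite ge0_integralZl ?lee_fin ?sqr_ge0//.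
- by apply: le_lt_trans (lee_wpmul2l _ (Vs u1)) _; rewrite ?lee_fin ?sqr_ge0// -EFinM ltry.
- apply/measurable_EFinP; apply: measurableT_comp => //.
  apply: measurable_funM => //; apply: measurable_funX; exact: measurable_dotv_rv.
Qed.

Lemma integrable_coordM a b :
  P.-integrable [set: T] (EFin \o (fun x => V x a 0 * V x b 0)).
Proof.
have nd c : norm2 (delta_mx c 0 : 'cV[R]_n) <= 1 by rewrite norm2_delta.
have dE c x : dotv (delta_mx c 0) (V x) = V x c 0.
  rewrite dotvE (bigD1 c)//= big1 => [|i i0]; last by rewrite !mxE (negPf i0) mul0r.
  by rewrite !mxE !eqxx mul1r addr0.
have mc c : measurable_fun [set: T] (fun x => V x c 0).
  by under eq_fun do rewrite -dE; exact: measurable_dotv_rv.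
have ii := integrableD measurableT (integrable_sqr_dotv (nd a)) (integrable_sqr_dotv (nd b)).
apply: (le_integrable measurableT _ _ ii).
  by apply/measurable_EFinP; exact: measurable_funM.
move=> x _ /=; rewrite lee_fin !dE.
rewrite [leRHS]ger0_norm ?addr_ge0 ?sqr_ge0// ler_norml.
by apply/andP; split; nra.
Qed.

Lemma integral_sqr_dotv (M : 'M[R]_n) u :
  (forall a b, (\int[P]_x (V x a 0%R * V x b 0%R)%R%:E = (M a b)%:E)%E) ->
  (\int[P]_x (dotv u (V x) ^+ 2)%:E = (dotv u (M *m u))%:E)%E.
Proof.
move=> hM.
transitivity (\int[P]_x (\sum_(ab : 'I_n * 'I_n)
    ((u ab.1 0 * u ab.2 0)%R%:E * (V x ab.1 0 * V x ab.2 0)%R%:E))%E)%E.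
  apply: eq_integral => x _; rewrite -(pair_bigA _ (fun a b =>
    ((u a 0 * u b 0)%R%:E * (V x a 0 * V x b 0)%R%:E)%E))/=.
  rewrite dotvE expr2 mulr_suml -sumEFin; apply: eq_bigr => a _.
  rewrite mulr_sumr -sumEFin; apply: eq_bigr => b _.
  by rewrite -EFinM mulrACA.
rewrite integral_sum//; last first.
  by move=> ab; apply: integrableZl => //; exact: integrable_coordM.
rewrite (eq_bigr (fun ab => (u ab.1 0 * u ab.2 0 * M ab.1 ab.2)%:E)); last first.
  by move=> ab _; rewrite integralZl ?hM//; exact: integrable_coordM.
rewrite sumEFin -(pair_bigA _ (fun a b => u a 0 * u b 0 * M a b))/= dotvE.
congr EFin; apply: eq_bigr => a _; rewrite mxE mulr_sumr.
by apply: eq_bigr => b _; rewrite mulrAC mulrA.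
Qed.

End Moments.
End SubGaussian.

(** * Independent pairs and the union bound *)

Section IndependentPair.
Context d (T : measurableType d) (R : realType) (P : probability T R).
Variables x y : T -> R.
Hypotheses (mx : measurable_fun [set: T] x) (my : measurable_fun [set: T] y).
Hypothesis xy : forall A C : set R, measurable A -> measurable C ->
  (P (x @^-1` A `&` y @^-1` C) = P (x @^-1` A) * P (y @^-1` C))%E.

(** [weighted_integral] twice: first with weight [g y], and for its hypothesis with
    an indicator of [x] as the weight. *)
Lemma integral_mul_indep_ge0 (f g : R -> R) (a b : R) :
  measurable_fun [set: R] f -> measurable_fun [set: R] g ->
  (forall t, 0 <= f t) -> (forall t, 0 <= g t) ->
  (\int[P]_w (f (x w))%:E = a%:E)%E -> (\int[P]_w (g (y w))%:E = b%:E)%E ->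
  (\int[P]_w (f (x w) * g (y w))%:E = (a * b)%:E)%E.
Proof.
move=> mf mg f0 g0 fa gb.
have mX A : measurable A -> measurable (x @^-1` A).
  by move=> mA; rewrite -[X in measurable X]setTI; apply: mx.
have mY A : measurable A -> measurable (y @^-1` A).
  by move=> mA; rewrite -[X in measurable X]setTI; apply: my.
rewrite (weighted_integral (X := x) (h := g \o y) (c := b))//.
- by rewrite fa -EFinM mulrC.
- exact: measurableT_comp.
- by move=> w; exact: g0.
move=> A mA.
have [p pE] : exists p, P (x @^-1` A) = p%:E.
  exists (fine (P (x @^-1` A))); rewrite fineK//.
  by apply: fin_num_measure; exact: mX.
transitivity (\int[P]_w (g (y w) * \1_A (x w))%:E)%E.
  by apply: eq_integral => w _; rewrite mulrC.
rewrite (weighted_integral (X := y) (h := fun w => \1_A (x w)) (c := p))//.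
- by rewrite gb pE -!EFinM mulrC.
- by apply: measurableT_comp mx; exact: measurable_indic.
move=> C mC; rewrite -pE.
rewrite -xy// -[in RHS](setIT (_ `&` _)) -integral_indic//; last first.
  by apply: measurableI; [exact: mX|exact: mY].
by apply: eq_integral => w _; rewrite indicI mulrC.
Qed.

(** By splitting [x] and [y] into positive and negative parts. *)
Lemma integral_mul_indep_mean0 :
  P.-integrable [set: T] (EFin \o x) -> P.-integrable [set: T] (EFin \o y) ->
  (\int[P]_w (y w)%:E = 0)%E -> (\int[P]_w (x w * y w)%:E = 0)%E.
Proof.
pose pos (t : R) := Num.max t 0; pose neg (t : R) := Num.max (- t) 0.
have posneg t : t = pos t - neg t.
  by rewrite /pos /neg; case: (leP t 0); case: (leP (- t) 0) => *; lra.
have pos0 t : 0 <= pos t by rewrite /pos le_max lexx orbT.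
have neg0 t : 0 <= neg t by rewrite /neg le_max lexx orbT.
have pos_le t : pos t <= `|t| by rewrite /pos ge_max ler_norm normr_ge0.
have neg_le t : neg t <= `|t| by rewrite /neg ge_max -normrN ler_norm normr_ge0.
have mpos : measurable_fun [set: R] pos by exact: measurable_maxr.
have mneg : measurable_fun [set: R] neg.
  by apply: measurable_maxr => //; exact: measurable_oppr.
move=> ix iy y0.
have int_part (z : T -> R) (f : R -> R) : measurable_fun [set: T] z ->
    measurable_fun [set: R] f -> (forall t, 0 <= f t) -> (forall t, f t <= `|t|) ->
    P.-integrable [set: T] (EFin \o z) ->
    P.-integrable [set: T] (EFin \o (fun w => f (z w))).
  move=> mz mf f0 fle iz; apply: (le_integrable measurableT _ _ iz).
    by apply/measurable_EFinP; exact: measurableT_comp mz.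
  by move=> w _ /=; rewrite lee_fin ger0_norm.
have fin (z : T -> R) : P.-integrable [set: T] (EFin \o z) ->
    exists a, (\int[P]_w (z w)%:E = a%:E)%E.
  move=> iz; exists (fine (\int[P]_w (z w)%:E)%E).
  by rewrite fineK// integrable_fin_num.
have ip z mz := @int_part z pos mz mpos pos0 pos_le.
have in_ z mz := @int_part z neg mz mneg neg0 neg_le.
have [a1 xa1] := fin _ (ip x mx ix); have [a2 xa2] := fin _ (in_ x mx ix).
have [b1 yb1] := fin _ (ip y my iy); have [b2 yb2] := fin _ (in_ y my iy).
have bb : b1 = b2.
  move: y0; under eq_integral do rewrite (posneg (y _)).
  rewrite integralB_EFin//; [|exact: ip|exact: in_].
  by rewrite yb1 yb2 -EFinB => -[]; lra.
have iprod (f g : R -> R) a b : measurable_fun [set: R] f -> measurable_fun [set: R] g ->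
    (forall t, 0 <= f t) -> (forall t, 0 <= g t) ->
    (\int[P]_w (f (x w))%:E = a%:E)%E -> (\int[P]_w (g (y w))%:E = b%:E)%E ->
    P.-integrable [set: T] (EFin \o (fun w => f (x w) * g (y w))).
  move=> mf mg f0 g0 fa gb; apply: integrable_real_lty.
    by apply: measurable_funM; [exact: measurableT_comp mx|exact: measurableT_comp my].
  under eq_integral do rewrite ger0_norm ?mulr_ge0//.
  by rewrite (integral_mul_indep_ge0 mf mg f0 g0 fa gb) ltry.
have E w : x w * y w =
    (pos (x w) * pos (y w) - pos (x w) * neg (y w)) -
    (neg (x w) * pos (y w) - neg (x w) * neg (y w)).
  by rewrite {1}(posneg (x w)) {1}(posneg (y w)); ring.
under eq_integral do rewrite E.
have i11 := iprod _ _ _ _ mpos mpos pos0 pos0 xa1 yb1.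
have i12 := iprod _ _ _ _ mpos mneg pos0 neg0 xa1 yb2.
have i21 := iprod _ _ _ _ mneg mpos neg0 pos0 xa2 yb1.
have i22 := iprod _ _ _ _ mneg mneg neg0 neg0 xa2 yb2.
rewrite integralB_EFin//; [|exact: (integrableB measurableT i11 i12)|exact: (integrableB measurableT i21 i22)].
rewrite !integralB_EFin//.
rewrite (integral_mul_indep_ge0 mpos mpos pos0 pos0 xa1 yb1).
rewrite (integral_mul_indep_ge0 mpos mneg pos0 neg0 xa1 yb2).
rewrite (integral_mul_indep_ge0 mneg mpos neg0 pos0 xa2 yb1).
rewrite (integral_mul_indep_ge0 mneg mneg neg0 neg0 xa2 yb2).
by rewrite -!EFinB bb; congr EFin; ring.
Qed.

End IndependentPair.

Section Concentration.
Context d (T : measurableType d) (R : realType) (P : probability T R).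

Lemma union_bound (U : eqType) (s : seq U) (G : U -> set T) (e : R) :
  (forall u, measurable (G u)) -> (forall u, u \in s -> (P (~` G u) <= e%:E)%E) ->
  exists E : set T, [/\ measurable E, (P (~` E) <= ((size s)%:R * e)%:E)%E &
    forall u, u \in s -> E `<=` G u].
Proof.
move=> mG; elim: s => [|u s IH] Ge.
  by exists setT; split => //; rewrite setCT measure0 mul0r.
have [|E [mE PE EG]] := IH; first by move=> v vs; apply: Ge; rewrite inE vs orbT.
exists (E `&` G u); split.
- exact: measurableI.
- rewrite setCI; apply: le_trans (measureU2 _ _ _) _ => /=; try exact: measurableC.
  rewrite -natr1 mulrDl mul1r EFinD; apply: leeD => //.
  by apply: Ge; rewrite inE eqxx.
- move=> v; rewrite inE => /predU1P[->|vs]; first exact: subIsetr.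
  by apply: subset_trans (EG _ vs); exact: subIsetl.
Qed.

End Concentration.

(** * Concentration of the sample second moment *)

Section SampleMoment.
Context d (T : measurableType d) (R : realType) (P : probability T R).
Variables (N n : nat) (V : 'I_N -> T -> 'cV[R]_n).

Definition sample_moment (w : T) : 'M[R]_n :=
  N%:R^-1 *: \sum_(i < N) V i w *m (V i w)^T.

Lemma sample_moment_tr w : (sample_moment w)^T = sample_moment w.
Proof.
rewrite /sample_moment linearZ linear_sum/=; congr (_ *: _).
by apply: eq_bigr => i _; rewrite trmx_mul trmxK.
Qed.

Lemma dotv_sample_moment w u :
  dotv u (sample_moment w *m u) = N%:R^-1 * \sum_(i < N) dotv u (V i w) ^+ 2.
Proof.
rewrite /sample_moment -scalemxAl dotvZr mulmx_suml; congr (_ * _).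
rewrite /dotv mulmx_sumr summxE; apply: eq_bigr => i _.
rewrite !mulmxA -mulmxA mxE big_ord1 expr2; congr (_ * _).
by rewrite -!/(dotv _ _) dotvC.
Qed.

Variables (s : R) (M : 'M[R]_n).
Hypotheses (mV : forall i, random_vector (V i)) (s0 : 0 < s).
Hypothesis V_ind : mutually_independent P V.
Hypothesis Vs : forall i, subgaussian P (V i) s.
Hypothesis VM : forall i a b,
  (\int[P]_x (V i x a 0%R * V i x b 0%R)%R%:E = (M a b)%:E)%E.

(** With [t = 50 sqrt (m / N)], Chernoff's bound at one point of the grid is
    [2 exp (- 2500 m / 128)], at most [2 exp (- 19 m)]: the size [2 ^ (18 m)] of the
    grid costs a factor [exp (18 m)].  Passing from the grid to the ball doubles
    [t], whence the constant 100 of [deviation].  [3 m <= N] keeps [t] in the range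
    of [chernoff_deviation]. *)
Lemma sample_moment_concentration m (L : 'M[R]_(m, n)) (k : R) :
  (0 < m)%N -> (3 * m <= N)%N -> 0 < k -> opbound L^T k ->
  exists E : set T, [/\ measurable E,
    (P (~` E) <= (2 * expR (- m%:R))%:E)%E &
    forall w, E w -> forall u,
      `|dotv u (L *m (sample_moment w - M) *m L^T *m u)| <=
        deviation k s m N * dotv u u].
Proof.
move=> m0 mN k0 Lk.
have N0 : (0 < N)%N by lia.
have N0' : (0 : R) < N%:R by rewrite ltr0n.
pose i0 := Ordinal N0.
have sM : M^T = M.
  apply/matrixP => a b; rewrite mxE; apply: EFin_inj; rewrite -!(VM i0).
  by apply: eq_integral => x _; rewrite mulrC.
pose t : R := 50 * Num.sqrt (m%:R / N%:R).
have t0 : 0 <= t by rewrite mulr_ge0// sqrtr_ge0.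
have tt : N%:R * t ^+ 2 = 2500 * m%:R.
  rewrite exprMn sqr_sqrtr ?divr_ge0// -natrX.
  by field; rewrite pnatr_eq0 -lt0n.
have t32 : t <= 32.
  rewrite -(ler_sqr t0 (ler0n _ 32)) -(ler_pM2l N0') tt.
  by have : (3 * m)%:R <= N%:R :> R; [rewrite ler_nat|rewrite natrM; lra].
pose q (v : 'cV[R]_n) (y : borel_cV R n) : R := dotv v (y : 'cV[R]_n) ^+ 2 / s ^+ 2.
have mq v : measurable_fun [set: borel_cV R n] (q v).
  by apply: measurable_funM => //; apply: measurable_funX; exact: measurable_dotv.
have q0 v y : 0 <= q v y by rewrite divr_ge0 ?sqr_ge0.
pose v (u : 'cV[R]_m) := k^-1 *: (L^T *m u).
pose mu u := dotv (v u) (M *m v u) / s ^+ 2.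
pose dev u w := \sum_i q (v u) (V i w) - N%:R * mu u.
pose bad u := [set w | N%:R * t <= `|dev u w|].
have mdev u : measurable_fun [set: T] (dev u).
  apply: measurable_funB => //; apply: measurable_sum => i.
  by apply: (measurableT_comp (mq _)); exact: mV.
have mbad u : measurable (bad u).
  by apply: measurable_superlevel; apply: measurableT_comp => //; exact: mdev.
have hV (A : 'I_N -> set (borel_cV R n)) : (forall i, measurable (A i)) ->
    (P (\bigcap_(i in [set: 'I_N]) (V i @^-1` A i)) = \prod_i P (V i @^-1` A i))%E.
  move=> mA; have := V_ind [set: 'I_N]%SET mA.
  rewrite (_ : [set` [set: 'I_N]%SET] = [set: 'I_N]).
    by move=> ->; apply: eq_bigl => i; rewrite inE.
  by apply/seteqP; split=> i //= _; rewrite inE.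
have Pbad u : u \in grid R m -> (P (~` ~` bad u) <= (2 * expR (- (19 * m%:R)))%:E)%E.
  move=> /(norm2_grid m0) u1; rewrite setCK.
  have v1 : norm2 (v u) <= 1.
    rewrite norm2Z gtr0_norm ?invr_gt0// ler_pdivrMl// mulr1.
    by apply: le_trans (Lk u) _; rewrite ler_piMr// ltW.
  apply: (@le_trans _ _ (2 * expR (- (N%:R * t ^+ 2 / 128)))%:E)%E.
    apply: (chernoff_deviation mV hV (mq _) (q0 _)) => [i|i|].
    - exact: Vs.
    - rewrite /q; under eq_integral do rewrite EFinM.
      rewrite ge0_integralZr//.
      + by rewrite (integral_sqr_dotv (mV i) s0 (Vs i) (v u) (VM i)) -EFinM.
      + apply/measurable_EFinP; apply: measurable_funX.
        exact: measurable_dotv_rv.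
      + by move=> x _; rewrite lee_fin sqr_ge0.
      + by rewrite lee_fin invr_ge0 sqr_ge0.
    - by rewrite t0.
  rewrite lee_fin ler_wpM2l// ler_expR lerN2 tt.
  by have : 0 <= m%:R :> R by []; lra.
have [E [mE PE EG]] := @union_bound _ _ _ P _ (grid R m) (fun u => ~` bad u) _
  (fun u => measurableC (mbad u)) Pbad.
exists E; split => //.
  apply: le_trans PE _; rewrite lee_fin.
  apply: (@le_trans _ _ ((2 ^+ 18) ^+ m * (2 * expR (- (19 * m%:R))))).
    by rewrite ler_wpM2r ?size_grid// mulr_ge0// expR_ge0.
  rewrite mulrCA ler_wpM2l//.
  apply: (@le_trans _ _ (expR 1 ^+ 18 ^+ m * expR (- (19 * m%:R)))).
    rewrite ler_wpM2r ?expR_ge0//; apply: lerXn2r; rewrite ?nnegrE ?exprn_ge0 ?expR_ge0//.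
    apply: lerXn2r; rewrite ?nnegrE ?expR_ge0//.
    by have := expR_ge1Dx (1 : R); rewrite -natr1.
  rewrite -!expRM_natl -expRD ler_expR.
  by have : 0 <= m%:R :> R by []; lra.
move=> w Ew u.
have -> : deviation k s m N = 2 * (k ^+ 2 * s ^+ 2 * t).
  by rewrite /deviation /t; ring.
apply: grid_quadratic u.
- by rewrite !trmx_mul trmxK linearB/= sM sample_moment_tr mulmxA.
- by apply: mulr_ge0 => //; apply: mulr_ge0; exact: sqr_ge0.
move=> u ug; have := EG u ug w Ew; rewrite /bad /= => /negP; rewrite -ltNge => h.
have -> : dotv u (L *m (sample_moment w - M) *m L^T *m u) =
          k ^+ 2 * s ^+ 2 * (N%:R^-1 * dev u w).
  have -> : dotv u (L *m (sample_moment w - M) *m L^T *m u) =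
      k ^+ 2 * dotv (v u) ((sample_moment w - M) *m v u).
    rewrite /v -scalemxAr dotvZl dotvZr -!mulmxA dotv_mulmxr.
    by field; rewrite gt_eqF.
  rewrite mulmxBl dotvBr dotv_sample_moment /dev /q /mu -mulr_suml.
  by field; rewrite !gt_eqF.
have c0 : 0 <= k ^+ 2 * s ^+ 2 by apply: mulr_ge0; exact: sqr_ge0.
rewrite normrM (ger0_norm c0) ler_wpM2l//.
rewrite normrM gtr0_norm ?invr_gt0// ler_pdivrMl//; exact: ltW.
Qed.

End SampleMoment.

(** * Gram matrices in an eigenbasis *)

Section Coordinates.
Variables (R : realType) (n : nat).
Implicit Types (U : 'M[R]_n) (u v : 'cV[R]_n).

Lemma dotv_coords U u v : U^T *m U = 1%:M ->
  dotv u v = \sum_i (U^T *m u) i 0 * (U^T *m v) i 0.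
Proof.
by move=> /mulmx1C UU; rewrite -dotvE dotv_mulmxl trmxK mulmxA UU mul1mx.
Qed.

Lemma dotv_gram_coords p (A : 'M[R]_(p, n)) U (lam : 'rV[R]_n) u v :
  U^T *m U = 1%:M -> A^T *m A *m U = U *m diag_mx lam ->
  dotv (A *m u) (A *m v) = \sum_i lam 0 i * ((U^T *m u) i 0 * (U^T *m v) i 0).
Proof.
move=> UU AU; rewrite dotv_mulmxl (dotv_coords _ _ UU).
apply: eq_bigr => i _; rewrite mulrCA; congr (_ * _).
have /mulmx1C UU' := UU.
have -> : U^T *m (A^T *m (A *m v)) = diag_mx lam *m (U^T *m v).
  rewrite -[v in LHS]mul1mx -UU' -!mulmxA.
  by rewrite (mulmxA A^T) (mulmxA (A^T *m A)) AU -!mulmxA (mulmxA U^T) UU mul1mx.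
rewrite mul_diag_mx mxE//.
Qed.

Lemma common_kernel m1 m2 (F1 : 'M[R]_(m1, n)) (F2 : 'M[R]_(m2, n)) :
  (\rank F1 + \rank F2 < n)%N ->
  exists v : 'cV[R]_n, [/\ v != 0, F1 *m v = 0 & F2 *m v = 0].
Proof.
move=> rk; pose G := kermx (col_mx F1 F2)^T.
have G0 : G != 0.
  apply: contraTneq rk => /eqP; rewrite -/G kermx_eq0 /row_free mxrank_tr => /eqP rG.
  rewrite -leqNgt -[X in (X <= _)%N]rG -(addsmxE F1 F2).
  exact: (mxrank_adds_leqif F1 F2).1.
exists (nz_row G)^T; rewrite -trmx0 (inj_eq trmx_inj) nz_row_eq0 G0.
have : nz_row G *m (col_mx F1 F2)^T = 0 by apply/sub_kermxP; exact: nz_row_sub.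
move/(congr1 trmx); rewrite trmx_mul trmxK mul_col_mx trmx0 => h.
by move: h; rewrite -[0 in RHS]vsubmxK => /eq_col_mx[-> ->]; rewrite !linear0.
Qed.

Lemma mul_pid_mxE r (c : 'cV[R]_n) i :
  ((pid_mx r : 'M[R]_n) *m c) i 0 = c i 0 *+ (i < r)%N.
Proof.
rewrite mxE (bigD1 i)//= big1 => [|j ji].
  by rewrite mxE eqxx/= addr0 mulr_natl.
by rewrite mxE eq_sym -val_eqE/= in ji *; rewrite (negPf ji) mul0r.
Qed.

Lemma mul_copid_mxE r (c : 'cV[R]_n) i :
  ((copid_mx r : 'M[R]_n) *m c) i 0 = c i 0 *+ (r <= i)%N.
Proof.
rewrite /copid_mx mulmxBl mul1mx mxE [X in _ + X]mxE mul_pid_mxE [in RHS]leqNgt.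
by case: (i < r)%N; rewrite /= ?mulr1n ?mulr0n ?subrr ?subr0.
Qed.

(** The dimension count of the Courant--Fischer principle: for orthogonal [U] and
    [W], [v] lies in the span of the columns of index [< r] of [W], and in that of
    the columns of index [>= r'] of [U]; the dimensions add up to more than [n]. *)
Lemma head_tail_meet U W r r' : (r' < r <= n)%N ->
  exists v, [/\ v != 0,
    forall i : 'I_n, (r <= i)%N -> (W^T *m v) i 0 = 0 &
    forall i : 'I_n, (i < r')%N -> (U^T *m v) i 0 = 0].
Proof.
move=> /andP[rr rn].
have [|v [v0 Wv Uv]] := @common_kernel n n (copid_mx r *m W^T) (pid_mx r' *m U^T).
  have h1 := mxrankM_maxl (copid_mx r : 'M[R]_n) W^T.
  have h2 := mxrankM_maxl (pid_mx r' : 'M[R]_n) U^T.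
  have h3 : (\rank (copid_mx r : 'M[R]_n) <= n - r)%N by rewrite rank_copid_mx.
  have h4 : (\rank (pid_mx r' : 'M[R]_n) <= r')%N.
    by rewrite rank_pid_mx// ltnW// (leq_trans rr).
  apply: (leq_ltn_trans (leq_add (leq_trans h1 h3) (leq_trans h2 h4))); lia.
exists v; split => // i ir.
  by move: Wv; rewrite -mulmxA => /matrixP/(_ i 0); rewrite mul_copid_mxE ir [RHS]mxE mulr1n.
by move: Uv; rewrite -mulmxA => /matrixP/(_ i 0); rewrite mul_pid_mxE ir [RHS]mxE mulr1n.
Qed.

End Coordinates.

Section GramBounds.
Variables (R : realType) (p n : nat) (A : 'M[R]_(p, n)) (U : 'M[R]_n).
Variable lam : 'rV[R]_n.
Hypothesis UU : U^T *m U = 1%:M.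
Hypothesis lam_sorted : forall i j : 'I_n, (i <= j)%N -> lam 0 j <= lam 0 i.
Hypothesis AU : A^T *m A *m U = U *m diag_mx lam.

Lemma gram_head_ge (r : nat) (a : R) v :
  (forall i : 'I_n, (i < r)%N -> a <= lam 0 i) ->
  (forall i : 'I_n, (r <= i)%N -> (U^T *m v) i 0 = 0) ->
  a * dotv v v <= dotv (A *m v) (A *m v).
Proof.
move=> ha hv; rewrite (dotv_gram_coords _ _ UU AU) (dotv_coords _ _ UU) mulr_sumr.
apply: ler_sum => i _; have [ir|ri] := ltnP i r.
  by rewrite ler_wpM2r ?ha// -expr2 sqr_ge0.
by rewrite hv// !mul0r !mulr0.
Qed.

Lemma gram_tail_le (r : nat) (a : R) v :
  (forall i : 'I_n, (r <= i)%N -> lam 0 i <= a) ->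
  (forall i : 'I_n, (i < r)%N -> (U^T *m v) i 0 = 0) ->
  dotv (A *m v) (A *m v) <= a * dotv v v.
Proof.
move=> ha hv; rewrite (dotv_gram_coords _ _ UU AU) (dotv_coords _ _ UU) mulr_sumr.
apply: ler_sum => i _; have [ir|ri] := ltnP i r.
  by rewrite hv// !mul0r !mulr0.
by rewrite ler_wpM2r ?ha// -expr2 sqr_ge0.
Qed.

(** Otherwise [A] would be injective on the span of [i + 1] columns of [U]. *)
Lemma gram_rank_eq0 (i : 'I_n) : (\rank A <= i)%N -> lam 0 i <= 0.
Proof.
move=> ri; set r := \rank A in ri.
have [|v [v0 Uv Av]] := @common_kernel _ _ n p (copid_mx i.+1 *m U^T) A.
  have h1 := mxrankM_maxl (copid_mx i.+1 : 'M[R]_n) U^T.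
  have h3 : (\rank (copid_mx i.+1 : 'M[R]_n) <= n - i.+1)%N by rewrite rank_copid_mx.
  apply: (leq_ltn_trans (leq_add (leq_trans h1 h3) (leqnn _))).
  by have := ltn_ord i; rewrite -/r; lia.
have : lam 0 i * dotv v v <= dotv (A *m v) (A *m v).
  apply: (@gram_head_ge i.+1) => j ij; first exact: lam_sorted.
  by move: Uv; rewrite -mulmxA => /matrixP/(_ j 0); rewrite mul_copid_mxE ij [RHS]mxE mulr1n.
rewrite Av dotv0r pmulr_lle0// lt_def dotv_eq0 v0; exact: dotv_ge0.
Qed.

End GramBounds.

(** * Perturbation of the weights *)

Section LastCols.
Variables (R : realType) (K d : nat) (U : 'M[R]_(K.+1)).
Hypothesis UU : U^T *m U = 1%:M.
Let Q := last_cols d U.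

Lemma mul_last_cols_trE m (v : 'M[R]_(K.+1, m)) j l :
  (Q^T *m v) j l = (U^T *m v) (inord (d + j)) l.
Proof. by rewrite !mxE; apply: eq_bigr => k _; rewrite !mxE. Qed.

Lemma mul_last_colsE i j : (U^T *m Q) i j = (i == inord (d + j))%:R.
Proof.
have := congr1 (fun X : 'M[R]_(K.+1) => X i (inord (d + j))) UU.
by rewrite !mxE => <-; apply: eq_bigr => k _; rewrite !mxE.
Qed.

Lemma inord_last (j : 'I_(K.+1 - d)) : (inord (d + j) : 'I_K.+1) = (d + j)%N :> nat.
Proof. by rewrite inordK//; have := ltn_ord j; lia. Qed.

Lemma last_cols_orth : Q^T *m Q = 1%:M.
Proof.
apply/matrixP => j k; rewrite mul_last_cols_trE mul_last_colsE mxE.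
by rewrite -val_eqE/= !inord_last eqn_add2l.
Qed.

Lemma last_cols_head0 (b : 'cV[R]_(K.+1 - d)) (i : 'I_K.+1) : (i < d)%N -> (U^T *m (Q *m b)) i 0 = 0.
Proof.
move=> id; rewrite mulmxA mxE big1// => j _; rewrite mul_last_colsE.
rewrite -val_eqE/= inord_last; have /negPf-> : (i : nat) != (d + j)%N by lia.
by rewrite mul0r.
Qed.

Lemma last_cols_compl (z : 'cV[R]_K.+1) (i : 'I_K.+1) : (d <= i)%N ->
  (U^T *m (z - Q *m (Q^T *m z))) i 0 = 0.
Proof.
move=> di; have jP : (i - d < K.+1 - d)%N by have := ltn_ord i; lia.
have -> : i = inord (d + Ordinal jP) by apply: ord_inj; rewrite inord_last/=; lia.
rewrite -mul_last_cols_trE mulmxBr (mulmxA Q^T) last_cols_orth mul1mx subrr.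
by rewrite mxE.
Qed.

Lemma norm2_last_cols b : norm2 (Q *m b) = norm2 b.
Proof.
by congr Num.sqrt; rewrite trmx_mul -mulmxA (mulmxA Q^T) last_cols_orth mul1mx.
Qed.

Lemma last_cols_form_coercive (S : 'M[R]_(K.+1)) c :
  coercive S c -> coercive (Q^T *m S *m Q) c.
Proof.
move=> Sc b; rewrite -!mulmxA dotv_mulmxr trmxK.
by rewrite -sqr_norm2 -norm2_last_cols sqr_norm2; exact: Sc.
Qed.

End LastCols.

Section Weights.
Variables (R : realType) (K m : nat) (Q : 'M[R]_(K.+1, m)) (S : 'M[R]_(K.+1)).
Hypothesis u : Q^T *m S *m Q \in unitmx.

Lemma weights_decomp : exists a, weights Q S = delta_mx ord0 ord0 - Q *m a.
Proof.
by exists (invmx (Q^T *m S *m Q) *m Q^T *m S *m delta_mx ord0 ord0); rewrite !mulmxA.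
Qed.

(** For a positive definite [S], the weights minimize the form of [S] on the affine
    space [e1 + range Q]; this is the first order condition. *)
Lemma weights_stationary : Q^T *m S *m weights Q S = 0.
Proof.
by rewrite /weights mulmxBr !mulmxA mulmxV// mul1mx subrr.
Qed.

End Weights.

Lemma coercive_le_opbound (R : realType) K (S : 'M[R]_(K.+1)) t T :
  coercive S t -> opbound S T -> t <= T.
Proof.
move=> St ST; have := St (delta_mx ord0 0).
have := opbound_bilin (delta_mx ord0 0) (delta_mx ord0 0) ST.
rewrite -sqr_norm2 norm2_delta expr1n !mulr1 ler_norml => /andP[_ h1 h2].
exact: le_trans h2 h1.
Qed.

(** [weights Q S] and its difference with the first basis vector are orthogonal
    for the form [S]. *)
Lemma weights_bounds (R : realType) K d (U S : 'M[R]_(K.+1)) t T :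
    let Q := last_cols d U in let e1 := delta_mx ord0 ord0 in
  U^T *m U = 1%:M -> 0 < t -> S^T = S -> coercive S t -> opbound S T ->
  norm2 (weights Q S) <= T / t /\ norm2 (e1 - weights Q S) <= T / t.
Proof.
move=> Q e1 UU t0 sS St ST; set w := weights Q S; set z := e1 - w.
have Q_unit : Q^T *m S *m Q \in unitmx.
  exact: coercive_unitmx t0 (last_cols_form_coercive UU St).
have [a wa] := weights_decomp Q S.
have za : z = Q *m a by rewrite /z /w wa opprB addrC subrK.
have zSw : dotv z (S *m w) = 0.
  rewrite za dotv_mulmxl mulmxA weights_stationary//; exact: dotv0r.
have e1E : e1 = w + z by rewrite /z addrC subrK.
have : dotv e1 (S *m e1) <= T.
  have := opbound_bilin e1 e1 ST.
  by rewrite ler_norml norm2_delta !mulr1 => /andP[].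
rewrite {1 2}e1E mulmxDr dotvDl !dotvDr zSw.
have -> : dotv w (S *m z) = 0 by rewrite dotv_mulmxr sS dotvC.
have := St w; have := St z; rewrite -!sqr_norm2 => hz hw hT.
have r1 : 1 <= T / t by rewrite ler_pdivlMr// mul1r (coercive_le_opbound St ST).
set r := T / t in r1 *.
have rt : r * t = T by rewrite mulfVK// gt_eqF.
have hr : r <= r ^+ 2 by rewrite expr2 ler_peMl// (le_trans _ r1).
have r0 : 0 <= r by apply: le_trans r1.
have wz : t * (norm2 w ^+ 2 + norm2 z ^+ 2) <= t * r by lra.
move: wz; rewrite ler_pM2l// => wz.
have := sqr_ge0 (norm2 w); have := sqr_ge0 (norm2 z).
by split; rewrite -ler_sqr ?nnegrE//; lra.
Qed.

Section Perturbation.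
Variables (R : realType) (p K d : nat).
Variables (B Bh : 'M[R]_(p, K.+1)) (S Sh nu nuh : 'M[R]_(K.+1)).
Variables (lam lamh : 'rV[R]_(K.+1)) (t T dl ep rho : R).
Hypotheses (t0 : 0 < t) (dl0 : 0 <= dl) (ep0 : 0 <= ep).
Hypotheses (dK : (d < K.+1)%N) (Bd : \rank B = d).
Hypotheses (UU : nu^T *m nu = 1%:M) (UUh : nuh^T *m nuh = 1%:M).
Hypothesis lam_sorted : forall i j : 'I_K.+1, (i <= j)%N -> lam 0 j <= lam 0 i.
Hypothesis lamh_sorted : forall i j : 'I_K.+1, (i <= j)%N -> lamh 0 j <= lamh 0 i.
Hypothesis BU : B^T *m B *m nu = nu *m diag_mx lam.
Hypothesis BhU : Bh^T *m Bh *m nuh = nuh *m diag_mx lamh.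
Hypothesis gap : forall i : 'I_K.+1, (i < d)%N -> t <= lam 0 i.
Let E : 'M[R]_(p, K.+1) := Bh - B.
Hypotheses (Edl : opbound E dl) (dlt : 4 * dl ^+ 2 <= t).
Hypotheses (sS : S^T = S) (St : coercive S t) (ST : opbound S T).
Hypotheses (Shep : opbound (Sh - S) ep) (ept : 2 * ep <= t).
Let Q := last_cols d nu.
Let Qh := last_cols d nuh.
Let w := weights Q S.
Let wh := weights Qh Sh.
Let z : 'cV[R]_K.+1 := delta_mx ord0 ord0 - w.
Hypothesis rhoP : norm2 (B^T *m E *m z) <= rho.

Let rho0 : 0 <= rho. Proof. exact: le_trans rhoP. Qed.

Let Bh_def (v : 'cV[R]_K.+1) : Bh *m v = B *m v + E *m v.
Proof. by rewrite -mulmxDl /E addrC subrK. Qed.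

Let lam_tail (i : 'I_K.+1) : (d <= i)%N -> lam 0 i <= 0.
Proof. by move=> di; apply: (gram_rank_eq0 UU lam_sorted BU); rewrite Bd. Qed.

(** Weyl: the span of [d + 1] leading right singular vectors of [Bh] meets the
    kernel of [B], on which [Bh] acts as [E]. *)
Let lamh_tail (i : 'I_K.+1) : (d <= i)%N -> lamh 0 i <= dl ^+ 2.
Proof.
move=> di; apply: le_trans (_ : lamh 0 (Ordinal dK) <= _); first exact: lamh_sorted.
have [|v [v0 hv tv]] := @head_tail_meet _ _ nu nuh d.+1 d; first by rewrite ltnSn.
have Bv : B *m v = 0.
  apply/eqP; rewrite -dotv_eq0 eq_le dotv_ge0 andbT.
  by have := gram_tail_le UU BU lam_tail tv; rewrite mul0r.
have h1 : lamh 0 (Ordinal dK) * dotv v v <= dotv (Bh *m v) (Bh *m v).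
  by apply: (gram_head_ge UUh BhU _ hv) => i' i'd; exact: lamh_sorted.
have h2 : dotv (Bh *m v) (Bh *m v) <= dl ^+ 2 * dotv v v.
  by rewrite Bh_def Bv add0r -!sqr_norm2 -exprMn ler_sqr ?nnegrE ?mulr_ge0.
have : 0 < dotv v v by rewrite lt_def dotv_eq0 v0 dotv_ge0.
by move=> /ler_pM2r <-; exact: le_trans h1 h2.
Qed.

(** Weyl: the span of the right singular vectors of [Bh] from the [d]-th on meets
    the orthogonal of the kernel of [B], on which [|B v| >= sqrt t |v|] and
    [|E v| <= sqrt t / 2 |v|]. *)
Let lamh_head (i : 'I_K.+1) : (i < d)%N -> t / 4 <= lamh 0 i.
Proof.
move=> id; have d'K : (d.-1 < K.+1)%N by lia.
apply: (@le_trans _ _ (lamh 0 (Ordinal d'K))); last first.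
  by apply: lamh_sorted; rewrite /=; lia.
have [|v [v0 hv tv]] := @head_tail_meet _ _ nuh nu d d.-1; first by lia.
have h1 : dotv (Bh *m v) (Bh *m v) <= lamh 0 (Ordinal d'K) * dotv v v.
  by apply: (gram_tail_le UUh BhU _ tv) => i' i'd; exact: lamh_sorted.
have h2 := gram_head_ge UU BU gap hv.
have vv : 0 < dotv v v by rewrite lt_def dotv_eq0 v0 dotv_ge0.
rewrite -(ler_pM2r vv); apply: le_trans h1.
have h3 : norm2 (E *m v) <= dl * norm2 v by exact: Edl.
have h4 : norm2 (B *m v) <= norm2 (Bh *m v) + norm2 (E *m v).
  have -> : B *m v = Bh *m v - E *m v by rewrite Bh_def addrK.
  exact: norm2B.
pose r := Num.sqrt t; have rr : r ^+ 2 = t by rewrite sqr_sqrtr// ltW.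
have r0 : 0 < r by rewrite sqrtr_gt0.
have dr : 2 * dl <= r.
  by rewrite -ler_sqr ?nnegrE ?mulr_ge0 ?(ltW r0)// rr exprMn -natrX.
have h5 : r * norm2 v <= norm2 (B *m v).
  by rewrite -ler_sqr ?nnegrE ?mulr_ge0 ?(ltW r0)// exprMn rr !sqr_norm2.
have h6 : r / 2 * norm2 v <= norm2 (Bh *m v).
  by have := norm2_ge0 v; nra.
have -> : t / 4 * dotv v v = (r / 2 * norm2 v) ^+ 2.
  by rewrite !exprMn rr sqr_norm2 exprVn -natrX.
by rewrite -sqr_norm2 ler_sqr ?nnegrE ?mulr_ge0 ?invr_ge0 ?(ltW r0).
Qed.

Let r := T / t.
(* The inverse of the lower bound [sqrt t / 2] on the singular value [d] of [Bh]. *)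
Let h := 2 / Num.sqrt t.

Let Q_unit : Q^T *m S *m Q \in unitmx.
Proof. exact: coercive_unitmx t0 (last_cols_form_coercive UU St). Qed.

Let Sh_coercive : coercive Sh (t / 2).
Proof.
move=> u; have -> : Sh = S + (Sh - S) by rewrite addrC subrK.
rewrite mulmxDl dotvDr; have := St u.
have := opbound_bilin u u Shep; rewrite ler_norml -expr2 sqr_norm2 => /andP[hl _].
have : ep * dotv u u <= t / 2 * dotv u u by rewrite ler_wpM2r ?dotv_ge0//; move: ept; lra.
by move: hl; lra.
Qed.

Let Qh_unit : Qh^T *m Sh *m Qh \in unitmx.
Proof.
apply: coercive_unitmx (last_cols_form_coercive UUh Sh_coercive).
by rewrite divr_gt0.
Qed.

Let tT : t <= T. Proof. exact: coercive_le_opbound St ST. Qed.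

Let r1 : 1 <= r. Proof. by rewrite ler_pdivlMr// mul1r. Qed.

Let h0 : 0 < h. Proof. by rewrite divr_gt0// sqrtr_gt0. Qed.

Let h_sqr : h ^+ 2 * t = 4.
Proof.
by rewrite exprMn exprVn sqr_sqrtr ?ltW// -mulrA mulVf ?gt_eqF// mulr1 -natrX.
Qed.

Let Sh_opbound : opbound Sh (2 * T).
Proof.
have -> : Sh = S + (Sh - S) by rewrite addrC subrK.
by apply: opbound_le (opboundD ST Shep); move: t0 ept tT; lra.
Qed.

Let w_bounds : norm2 w <= r /\ norm2 z <= r.
Proof. exact: weights_bounds t0 sS St ST. Qed.

Let tail_small x : (forall i : 'I_K.+1, (i < d)%N -> (nuh^T *m x) i 0 = 0) ->
  norm2 (Bh *m x) <= dl * norm2 x.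
Proof.
move=> hx; rewrite -ler_sqr ?nnegrE ?mulr_ge0// exprMn !sqr_norm2.
exact: (gram_tail_le UUh BhU lamh_tail hx).
Qed.

Let head_large x : (forall i : 'I_K.+1, (d <= i)%N -> (nuh^T *m x) i 0 = 0) ->
  norm2 x <= h * norm2 (Bh *m x).
Proof.
move=> hx; rewrite -ler_sqr ?nnegrE ?mulr_ge0 ?(ltW h0)// exprMn !sqr_norm2.
have := gram_head_ge UUh BhU lamh_head hx.
have hh : 0 <= h ^+ 2 by exact: sqr_ge0.
by move=> /(ler_wpM2l hh); rewrite mulrA mulrA h_sqr divff// mul1r.
Qed.

Let y := z - Qh *m (Qh^T *m z).

Let Bz : B *m z = 0.
Proof.
have [a wa] := weights_decomp Q S.
have za : z = Q *m a by rewrite /z /w wa opprB addrC subrK.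
apply/eqP; rewrite -dotv_eq0 eq_le dotv_ge0 andbT.
have hz (i : 'I_K.+1) : (i < d)%N -> (nu^T *m z) i 0 = 0.
  by rewrite za; exact: last_cols_head0.
by have := gram_tail_le UU BU lam_tail hz; rewrite mul0r.
Qed.

(* [Bh y] is orthogonal to [Bh (z - y)], and [Bh z = E z]. *)
Let Bhy_sqr : norm2 (Bh *m y) ^+ 2 = dotv (Bh *m y) (E *m z).
Proof.
have hy := last_cols_compl UUh z; rewrite -/y in hy.
have -> : E *m z = Bh *m z by rewrite Bh_def Bz add0r.
have -> : Bh *m z = Bh *m y + Bh *m (Qh *m (Qh^T *m z)).
  by rewrite -mulmxDr /y subrK.
rewrite dotvDr sqr_norm2 (dotv_gram_coords y (Qh *m _) UUh BhU).
rewrite big1 ?addr0// => i _; have [id|di] := ltnP i d.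
  by rewrite (last_cols_head0 UUh)// !mulr0.
by rewrite hy// mul0r mulr0.
Qed.

Let y_small : norm2 y <= h * dl * r.
Proof.
have := head_large (last_cols_compl UUh z); rewrite -/y => hy.
suff : norm2 (Bh *m y) <= dl * r.
  by move=> hB; apply: le_trans hy _; rewrite -mulrA ler_wpM2l// ltW.
have [->|] := eqVneq (norm2 (Bh *m y)) 0.
  by rewrite mulr_ge0// (le_trans _ r1).
rewrite norm2_eq0 -norm2_gt0 => B0; rewrite -(ler_pM2l B0) -expr2 Bhy_sqr.
apply: le_trans (dotv_le _ _) _; rewrite ler_wpM2l//.
by apply: le_trans (Edl z) _; rewrite ler_wpM2l// w_bounds.2.
Qed.

(** The part of the error outside the estimated kernel: only [rho] is of first
    order in [E]. *)
Let Bhy_small : norm2 (Bh *m y) <= h * (rho + dl ^+ 2 * r).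
Proof.
have := head_large (last_cols_compl UUh z); rewrite -/y => hy.
have [->|] := eqVneq (norm2 (Bh *m y)) 0.
  rewrite mulr_ge0 ?(ltW h0)// addr_ge0// mulr_ge0 ?sqr_ge0//.
  exact: le_trans r1.
rewrite norm2_eq0 -norm2_gt0 => B0; rewrite -(ler_pM2l B0) -expr2 Bhy_sqr.
rewrite mulrA [_ * h]mulrC {1}Bh_def dotvDl.
have b1 : dotv (B *m y) (E *m z) <= norm2 y * rho.
  rewrite dotv_mulmxl mulmxA; apply: le_trans (dotv_le _ _) _.
  by rewrite ler_wpM2l.
have b2 : dotv (E *m y) (E *m z) <= norm2 y * (dl ^+ 2 * r).
  apply: le_trans (dotv_le _ _) _.
  have -> : norm2 y * (dl ^+ 2 * r) = (dl * norm2 y) * (dl * r) by ring.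
  apply: ler_pM => //; apply: le_trans (Edl z) _.
  by rewrite ler_wpM2l// w_bounds.2.
apply: le_trans (lerD b1 b2) _; rewrite -mulrDr ler_wpM2r//.
by rewrite addr_ge0// mulr_ge0 ?sqr_ge0// (le_trans _ r1).
Qed.

Let x := Qh *m (Qh^T *m (wh - w)).

Let split_err : wh - w = x + y.
Proof.
have [a wa] := weights_decomp Qh Sh.
have zE : wh - w = z - Qh *m a by rewrite /z /wh wa addrAC.
rewrite /x zE mulmxBr (mulmxA Qh^T Qh) last_cols_orth// mul1mx mulmxBr /y.
by rewrite addrA [_ + z]addrC addrA addrAC addrK.
Qed.

(** The estimated kernel is close to the kernel, so that [S w], orthogonal to the
    latter, is almost orthogonal to [x]. *)
Let x_Sw : - dotv x (S *m w) <= h * dl * norm2 x * (T * r).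
Proof.
pose x' := x - Q *m (Q^T *m x).
have hx : norm2 (Bh *m x) <= dl * norm2 x.
  by apply: tail_small => i; exact: last_cols_head0.
have Bx : B *m x' = B *m x.
  rewrite mulmxBr [X in _ - X](_ : _ = 0) ?subr0//.
  apply/eqP; rewrite -dotv_eq0 eq_le dotv_ge0 andbT.
  have := gram_tail_le UU BU lam_tail (fun i => @last_cols_head0 _ _ _ _ UU (Q^T *m x) i).
  by rewrite mul0r.
have Bx2 : norm2 (B *m x) <= 2 * dl * norm2 x.
  have -> : B *m x = Bh *m x - E *m x by rewrite Bh_def addrK.
  by apply: le_trans (norm2B _ _) _; have := Edl x; move: hx; lra.
have x'_le : norm2 x' <= h * dl * norm2 x.
  have := gram_head_ge UU BU gap (last_cols_compl UU x); rewrite -/Q -/x' Bx => g.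
  rewrite -ler_sqr ?nnegrE ?mulr_ge0 ?(ltW h0)//.
  rewrite -(ler_pM2l t0) sqr_norm2; apply: le_trans g _; rewrite -sqr_norm2.
  have -> : t * (h * dl * norm2 x) ^+ 2 = (2 * dl * norm2 x) ^+ 2.
    transitivity (h ^+ 2 * t * (dl * norm2 x) ^+ 2); first by ring.
    by rewrite h_sqr; ring.
  by rewrite ler_sqr ?nnegrE ?mulr_ge0.
have -> : dotv x (S *m w) = dotv x' (S *m w).
  rewrite dotvBl [X in _ = _ - X](_ : _ = 0) ?subr0//.
  rewrite dotv_mulmxl mulmxA weights_stationary//; exact: dotv0r.
rewrite -dotvNl; apply: le_trans (dotv_le _ _) _; rewrite norm2N.
apply: ler_pM => //; apply: le_trans (ST w) _.
by rewrite ler_wpM2l ?w_bounds.1// (le_trans (ltW t0)).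
Qed.

Let x_small : norm2 x <= 2 / t * (ep * r + 3 * (h * T * r * dl)).
Proof.
have r0 : 0 <= r by apply: le_trans r1.
have T0 : 0 <= T by apply: le_trans tT; exact: ltW.
have := Sh_coercive x; rewrite -sqr_norm2 => c.
have xSwh : dotv x (Sh *m wh) = 0.
  rewrite /x dotv_mulmxl mulmxA weights_stationary//; exact: dotv0r.
have xE : x = wh - w - y by rewrite split_err addrK.
have E1 : dotv x (Sh *m x) =
    - dotv x ((Sh - S) *m w) - dotv x (S *m w) - dotv x (Sh *m y).
  rewrite {2}xE mulmxBr mulmxBr mulmxBl !dotvBr xSwh; ring.
have b1 : - dotv x ((Sh - S) *m w) <= norm2 x * (ep * r).
  rewrite -dotvNr; apply: le_trans (dotv_le _ _) _; rewrite norm2N ler_wpM2l//.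
  by apply: le_trans (Shep w) _; rewrite ler_wpM2l// w_bounds.1.
have b3 : - dotv x (Sh *m y) <= norm2 x * (2 * T * (h * dl * r)).
  rewrite -dotvNr; apply: le_trans (dotv_le _ _) _; rewrite norm2N ler_wpM2l//.
  by apply: le_trans (Sh_opbound y) _; rewrite ler_wpM2l// mulr_ge0.
have b2 := x_Sw.
have [->|] := eqVneq (norm2 x) 0.
  apply: mulr_ge0; first by apply: divr_ge0 => //; exact: ltW.
  apply: addr_ge0; first exact: mulr_ge0.
  exact: mulr_ge0 (ler0n _ 3) (mulr_ge0 (mulr_ge0 (mulr_ge0 (ltW h0) T0) r0) dl0).
rewrite norm2_eq0 -norm2_gt0 => x0.
have -> : 2 / t = (t / 2)^-1 by rewrite invf_div.
rewrite ler_pdivlMl ?divr_gt0// -(ler_pM2l x0).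
apply: le_trans (_ : dotv x (Sh *m x) <= _).
  by apply: le_trans c; rewrite expr2; lra.
by rewrite E1; move: b1 b2 b3; lra.
Qed.

Definition perturbation_const : R := h + h * r + 2 / t * r + 6 / t * (h * T * r).

Lemma weights_perturbation :
  Qh^T *m Sh *m Qh \in unitmx /\
  norm2 (Bh *m (wh - w)) <= perturbation_const * (rho + dl ^+ 2 + dl * ep).
Proof.
split; first exact: Qh_unit.
have r0 : 0 <= r by apply: le_trans r1.
have T0 : 0 <= T by apply: le_trans tT; exact: ltW.
have hx : norm2 (Bh *m x) <= dl * norm2 x.
  by apply: tail_small => i; exact: last_cols_head0.
rewrite split_err mulmxDr; apply: le_trans (norm2D _ _) _.
apply: le_trans (lerD hx Bhy_small) _.
apply: le_trans (lerD (ler_wpM2l dl0 x_small) (lexx _)) _.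
rewrite /perturbation_const.
have -> : dl * (2 / t * (ep * r + 3 * (h * T * r * dl))) + h * (rho + dl ^+ 2 * r) =
    h * rho + h * r * dl ^+ 2 + 2 / t * r * (dl * ep) + 6 / t * (h * T * r) * dl ^+ 2.
  by ring.
have c1 : 0 <= h * r by exact: mulr_ge0 (ltW h0) r0.
have c2 : 0 <= 2 / t * r by rewrite mulr_ge0// divr_ge0// ltW.
have c3 : 0 <= 6 / t * (h * T * r).
  apply: mulr_ge0; first by rewrite divr_ge0// ltW.
  exact: mulr_ge0 (mulr_ge0 (ltW h0) T0) r0.
set X := rho + _ + _.
have d2 := sqr_ge0 dl; have de : 0 <= dl * ep by rewrite mulr_ge0.
have X1 : rho <= X by rewrite /X -addrA lerDl addr_ge0.
have X2 : dl ^+ 2 <= X by rewrite /X addrAC lerDr addr_ge0.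
have X3 : dl * ep <= X by rewrite /X lerDr addr_ge0.
have := ler_wpM2l (ltW h0) X1; have := ler_wpM2l c1 X2.
have := ler_wpM2l c2 X3; have := ler_wpM2l c3 X2.
move: (h * r) (2 / t * r) (6 / t * (h * T * r)) => a1 a2 a3; lra.
Qed.

End Perturbation.

(** * The least squares estimators in block form *)

Section Blocks.
Variable R : realType.

Lemma dotv_col_mx m n (a c : 'cV[R]_m) (b e : 'cV[R]_n) :
  dotv (col_mx a b) (col_mx c e) = dotv a c + dotv b e.
Proof. by rewrite /dotv tr_col_mx mul_row_col mxE. Qed.

Lemma norm2_col_mx0 m n (a : 'cV[R]_m) : norm2 (col_mx a (0 : 'cV[R]_n)) = norm2 a.
Proof. by rewrite /norm2 -!/(dotv _ _) dotv_col_mx dotv0r addr0. Qed.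

Lemma norm2_col_0mx m n (b : 'cV[R]_n) : norm2 (col_mx (0 : 'cV[R]_m) b) = norm2 b.
Proof. by rewrite /norm2 -!/(dotv _ _) dotv_col_mx dotv0r add0r. Qed.

Lemma norm2_usub_le m n (a : 'cV[R]_m) (b : 'cV[R]_n) : norm2 a <= norm2 (col_mx a b).
Proof.
apply: norm2_le; first exact: norm2_ge0.
by rewrite sqr_norm2 dotv_col_mx lerDl dotv_ge0.
Qed.

Lemma norm2_dsub_le m n (a : 'cV[R]_m) (b : 'cV[R]_n) : norm2 b <= norm2 (col_mx a b).
Proof.
apply: norm2_le; first exact: norm2_ge0.
by rewrite sqr_norm2 dotv_col_mx lerDr dotv_ge0.
Qed.

Lemma opbound_block m1 m2 n1 n2 (A : 'M[R]_(m1, n1)) (B : 'M[R]_(m1, n2))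
    (C : 'M[R]_(m2, n1)) (D : 'M[R]_(m2, n2)) c :
  opbound (block_mx A B C D) c -> [/\ opbound A c, opbound B c & opbound D c].
Proof.
move=> h; split=> u.
- have := h (col_mx u 0); rewrite norm2_col_mx0 mul_block_col !mulmx0 !addr0.
  exact: le_trans (norm2_usub_le _ _).
- have := h (col_mx 0 u); rewrite norm2_col_0mx mul_block_col !mulmx0 !add0r.
  exact: le_trans (norm2_usub_le _ _).
- have := h (col_mx 0 u); rewrite norm2_col_0mx mul_block_col !mulmx0 !add0r.
  exact: le_trans (norm2_dsub_le _ _).
Qed.

Lemma opbound_block_diag m1 m2 n1 n2 (A : 'M[R]_(m1, n1)) (D : 'M[R]_(m2, n2)) a b :
  0 <= a -> 0 <= b -> opbound A a -> opbound D b ->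
  opbound (block_mx A 0 0 D) (a + b).
Proof.
move=> a0 b0 hA hD u; rewrite -[u]vsubmxK mul_block_col !mul0mx addr0 add0r.
set v := usubmx u; set w := dsubmx u.
apply: norm2_le; first by rewrite mulr_ge0 ?addr_ge0.
rewrite exprMn sqr_norm2 !dotv_col_mx -!sqr_norm2 mulrDr; apply: lerD.
  rewrite -exprMn ler_sqr ?nnegrE ?mulr_ge0 ?addr_ge0//.
  by apply: le_trans (hA v) _; rewrite ler_wpM2r// lerDl.
rewrite -exprMn ler_sqr ?nnegrE ?mulr_ge0 ?addr_ge0//.
by apply: le_trans (hD w) _; rewrite ler_wpM2r// lerDr.
Qed.

Lemma sum_block_mx (I : Type) (r : seq I) m1 m2 n1 n2
    (A : I -> 'M[R]_(m1, n1)) (B : I -> 'M[R]_(m1, n2))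
    (C : I -> 'M[R]_(m2, n1)) (D : I -> 'M[R]_(m2, n2)) :
  \sum_(i <- r) block_mx (A i) (B i) (C i) (D i) =
  block_mx (\sum_(i <- r) A i) (\sum_(i <- r) B i) (\sum_(i <- r) C i) (\sum_(i <- r) D i).
Proof.
elim: r => [|i r IH]; first by rewrite !big_nil block_mx0.
by rewrite !big_cons IH add_block_mx.
Qed.

End Blocks.

Section Estimator.
Variables (R : realType) (N p K : nat).
Variables (x : 'I_N -> 'cV[R]_p) (e y : 'I_N -> 'cV[R]_K.+1) (B : 'M[R]_(p, K.+1)).
Hypothesis y_def : forall i k, y i k 0 = ((x i)^T *m col k B) 0 0 + e i k 0.

Let Sh := Sxx_hat x.
Let G : 'M[R]_(p, K.+1) := N%:R^-1 *: \sum_(i < N) x i *m (e i)^T.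
Let See : 'M[R]_K.+1 := N%:R^-1 *: \sum_(i < N) e i *m (e i)^T.

Let y_vec i : y i = B^T *m x i + e i.
Proof.
apply/matrixP => k j; rewrite ord1 y_def mxE [in RHS]mxE; congr (_ + _).
by rewrite mxE; apply: eq_bigr => a _; rewrite !mxE mulrC.
Qed.

Lemma second_moment_block :
  N%:R^-1 *: (\sum_(i < N) col_mx (x i) (e i) *m (col_mx (x i) (e i))^T) =
  block_mx Sh G G^T See.
Proof.
have -> : G^T = N%:R^-1 *: \sum_(i < N) e i *m (x i)^T.
  rewrite /G linearZ linear_sum/=; congr (_ *: _).
  by apply: eq_bigr => i _; rewrite trmx_mul trmxK.
rewrite /Sh /Sxx_hat /G /See -scale_block_mx -sum_block_mx; congr (_ *: _).
by apply: eq_bigr => i _; rewrite tr_col_mx mul_col_row.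
Qed.

Hypothesis ShU : Sh \in unitmx.
Let E : 'M[R]_(p, K.+1) := B_hat x y - B.

Lemma B_hat_error : E = invmx Sh *m G.
Proof.
suff BhE : B_hat x y = invmx Sh *m (Sh *m B + G).
  by rewrite /E BhE mulmxDr mulmxA mulVmx// mul1mx addrC addKr.
have -> : Sh *m B + G = N%:R^-1 *: \sum_(i < N) x i *m (y i)^T.
  rewrite /Sh /Sxx_hat /G -scalemxAl -scalerDr mulmx_suml -big_split/=.
  congr (_ *: _); apply: eq_bigr => i _.
  by rewrite y_vec linearD/= trmx_mul trmxK mulmxDr mulmxA.
apply/matrixP => a k; rewrite mxE [LHS]mxE [RHS]mxE; apply: eq_bigr => b _.
congr (_ * _); rewrite /Sxy_hat !mxE summxE [in RHS]summxE; congr (_ * _).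
by apply: eq_bigr => i _; rewrite !mxE big_ord1 !mxE mulrC.
Qed.

(** The residual of observation [i] is [e i - E^T x i]; the cross terms of its
    second moment combine through the normal equations [Sxx_hat E = G]. *)
Lemma Seps_hat_error : Seps_hat x y = See - G^T *m E.
Proof.
have quad (F : 'M[R]_(p, K.+1)) a b : (b - F^T *m a) *m (b - F^T *m a)^T =
    b *m b^T - (a *m b^T)^T *m F - F^T *m (a *m b^T) + F^T *m (a *m a^T) *m F.
  have -> : (b - F^T *m a)^T = b^T - a^T *m F by rewrite linearB/= trmx_mul trmxK.
  rewrite mulmxBl !mulmxBr trmx_mul trmxK.
  by rewrite !mulmxA opprB addrA addrAC.
have ShE : Sh *m E = G by rewrite B_hat_error mulmxA mulmxV// mul1mx.
pose v i := e i - E^T *m x i.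
have resE i k : residual x y i k = v i k 0.
  have -> : v i = y i - (B_hat x y)^T *m x i.
    by rewrite /v y_vec /E linearB/= mulmxBl opprB addrA [e i + _]addrC.
  rewrite /residual [RHS]mxE [X in _ = _ + X]mxE; congr (_ - _).
  rewrite mxE [RHS]mxE.
  by apply: eq_bigr => a _; rewrite !mxE mulrC.
have -> : Seps_hat x y = N%:R^-1 *: \sum_(i < N) v i *m (v i)^T.
  apply/matrixP => k l; rewrite mxE [RHS]mxE summxE; congr (_ * _).
  apply: eq_bigr => i _; rewrite !resE [RHS]mxE big_ord1; congr (_ * _).
  by rewrite [RHS]mxE.
have -> : \sum_(i < N) v i *m (v i)^T =
    \sum_(i < N) e i *m (e i)^T - (\sum_(i < N) x i *m (e i)^T)^T *m E
    - E^T *m (\sum_(i < N) x i *m (e i)^T)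
    + E^T *m (\sum_(i < N) x i *m (x i)^T) *m E.
  rewrite linear_sum/= !mulmx_suml !mulmx_sumr mulmx_suml -!sumrB -big_split/=.
  apply: eq_bigr => i _; exact: quad.
rewrite scalerDr !scalerBr.
have -> : N%:R^-1 *: ((\sum_(i < N) x i *m (e i)^T)^T *m E) = G^T *m E.
  by rewrite scalemxAl /G linearZ.
have -> : N%:R^-1 *: (E^T *m (\sum_(i < N) x i *m (e i)^T)) = E^T *m G.
  by rewrite scalemxAr.
have -> : N%:R^-1 *: (E^T *m (\sum_(i < N) x i *m (x i)^T) *m E) = E^T *m Sh *m E.
  by rewrite scalemxAl scalemxAr.
by rewrite -mulmxA ShE subrK.
Qed.

End Estimator.

(** * The estimation error on a given sample *)

Section EstimationError.
Variables (R : realType) (N p K d : nat).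
Variables (x : 'I_N -> 'cV[R]_p) (e y : 'I_N -> 'cV[R]_K.+1) (B : 'M[R]_(p, K.+1)).
Variables (Sxx : 'M[R]_p) (Seps nu nuh : 'M[R]_(K.+1)) (lam lamh : 'rV[R]_(K.+1)).
Variables (t T b dl gm : R).
Hypothesis y_def : forall i k, y i k 0 = ((x i)^T *m col k B) 0 0 + e i k 0.
Hypotheses (t0 : 0 < t) (b0 : 0 <= b) (dl0 : 0 <= dl).
Hypotheses (dlt : 4 * dl <= t) (dlt3 : 16 * dl ^+ 2 <= t ^+ 3).
Hypotheses (sSxx : Sxx^T = Sxx) (Sxxt : coercive Sxx t).
Hypotheses (sSeps : Seps^T = Seps) (Sepst : coercive Seps t) (SepsT : opbound Seps T).
Hypotheses (Bb : opbound B b) (Bd : \rank B = d) (dK : (d < K.+1)%N).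
Hypotheses (UU : nu^T *m nu = 1%:M) (UUh : nuh^T *m nuh = 1%:M).
Hypothesis lam_sorted : forall i j : 'I_K.+1, (i <= j)%N -> lam 0 j <= lam 0 i.
Hypothesis lamh_sorted : forall i j : 'I_K.+1, (i <= j)%N -> lamh 0 j <= lamh 0 i.
Hypothesis BU : B^T *m B *m nu = nu *m diag_mx lam.
Let Bh := B_hat x y.
Hypothesis BhU : Bh^T *m Bh *m nuh = nuh *m diag_mx lamh.
Hypothesis gap : forall i : 'I_K.+1, (i < d)%N -> t <= lam 0 i.
Let w := weights (last_cols d nu) Seps.
Let z : 'cV[R]_K.+1 := delta_mx ord0 ord0 - w.
Let D := N%:R^-1 *: (\sum_(i < N) col_mx (x i) (e i) *m (col_mx (x i) (e i))^T)
  - block_mx Sxx 0 0 Seps.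
(* The upper right block of [W^T D W] is [B^T Sxx^-1 G z], the first order term. *)
Let W := block_mx (invmx Sxx *m B) 0 0 z.
Hypotheses (Ddl : opbound D dl) (Dgm : opbound (W^T *m D *m W) gm).

(** [weights_perturbation], with [|E| <= 2 dl / t] and an error of at most [2 dl] on
    [Seps]; replacing [Sxx_hat^-1] by [Sxx^-1] in [B^T E z] costs a second order
    term. *)
Lemma estimation_error :
  let Qh := last_cols d nuh in
  let wh := weights Qh (Seps_hat x y) in
  [/\ Sxx_hat x \in unitmx, Qh^T *m Seps_hat x y *m Qh \in unitmx &
      norm2 (beta_weighted x y wh - beta_weighted x y w) <=
      perturbation_const t T *
        (gm + (2 * b * (T / t) / t ^+ 2 + 4 / t ^+ 2 + 4 / t) * dl ^+ 2)].
Proof.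
move=> Qh wh.
pose G : 'M[R]_(p, K.+1) := N%:R^-1 *: \sum_(i < N) x i *m (e i)^T.
pose See : 'M[R]_K.+1 := N%:R^-1 *: \sum_(i < N) e i *m (e i)^T.
have DE : D = block_mx (Sxx_hat x - Sxx) G G^T (See - Seps).
  by rewrite /D second_moment_block opp_block_mx add_block_mx !subr0.
have [hS hG hSe] : [/\ opbound (Sxx_hat x - Sxx) dl, opbound G dl & opbound (See - Seps) dl].
  by move: Ddl; rewrite DE => /opbound_block.
have Shc : coercive (Sxx_hat x) (t / 2).
  move=> u; have -> : Sxx_hat x = Sxx + (Sxx_hat x - Sxx) by rewrite addrC subrK.
  rewrite mulmxDl dotvDr; have := Sxxt u.
  have := opbound_bilin u u hS; rewrite ler_norml -expr2 sqr_norm2 => /andP[hl _].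
  have : dl * dotv u u <= t / 2 * dotv u u.
    by rewrite ler_wpM2r ?dotv_ge0//; move: t0 dlt; lra.
  by move: hl; lra.
have t2 : 0 < t / 2 by rewrite divr_gt0.
have ShU := coercive_unitmx t2 Shc.
have hShV : opbound (invmx (Sxx_hat x)) (2 / t).
  by have := coercive_invmx t2 Shc; rewrite invf_div.
have SxxU := coercive_unitmx t0 Sxxt.
have hSxxV := coercive_invmx t0 Sxxt.
pose E : 'M[R]_(p, K.+1) := B_hat x y - B.
have EE : E = invmx (Sxx_hat x) *m G by exact: B_hat_error.
have t2' : 0 <= 2 / t by rewrite divr_ge0// ltW.
have hE : opbound E (2 / t * dl) by rewrite EE; exact: opboundM.
have hGT : opbound G^T dl by exact: opbound_tr.
have hSeps : opbound (Seps_hat x y - Seps) (2 * dl).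
  rewrite (Seps_hat_error y_def ShU) -/G -/See -/E addrAC.
  apply: opbound_le (opboundD hSe (opboundN (opboundM dl0 hGT hE))).
  have -> : 2 * dl = dl + dl * 1 by ring.
  rewrite lerD2l ler_wpM2l// mulrAC ler_pdivrMr// mul1r.
  by move: dl0 dlt; lra.
have [_ zr] := weights_bounds d UU t0 sSeps Sepst SepsT; rewrite -/w -/z in zr.
pose rho := gm + b * (2 / t * (dl * t^-1)) * dl * (T / t).
have hrho : norm2 (B^T *m E *m z) <= rho.
  have -> : B^T *m E *m z = (invmx Sxx *m B)^T *m G *m z +
      B^T *m (invmx (Sxx_hat x) *m ((Sxx - Sxx_hat x) *m invmx Sxx)) *m G *m z.
    rewrite trmx_mul trmx_inv sSxx -!mulmxDl -mulmxDr; congr (_ *m _).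
    rewrite EE mulmxA; congr (_ *m _ *m _).
    by rewrite mulmxBl mulmxV// mulmxBr mulmx1 mulmxA mulVmx// mul1mx addrC subrK.
  apply: le_trans (norm2D _ _) (lerD _ _).
    have : opbound ((invmx Sxx *m B)^T *m G *m z) gm.
      have := Dgm; rewrite DE /W tr_block_mx !trmx0 !mulmx_block.
      rewrite !mul0mx !mulmx0 !addr0 !add0r.
      by case/opbound_block.
    have e1 : 1%:M = delta_mx 0 0 :> 'M[R]_1.
      by apply/matrixP => i j; rewrite !ord1 !mxE.
    by move=> /(_ 1%:M); rewrite mulmx1 e1 norm2_delta mulr1.
  apply: le_trans (_ : b * (2 / t * (dl * t^-1)) * dl * norm2 z <= _); last first.
    by rewrite ler_wpM2l// !mulr_ge0// invr_ge0 ltW.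
  have hS' : opbound (Sxx - Sxx_hat x) dl.
    by rewrite -opprB; exact: opboundN.
  apply: (opboundM _ (opboundM b0 (opbound_tr b0 Bb)
    (opboundM t2' hShV (opboundM dl0 hS' hSxxV))) hG).
  by rewrite !mulr_ge0// invr_ge0 ltW.
have dl'0 : 0 <= 2 / t * dl by rewrite mulr_ge0.
have ep0 : 0 <= 2 * dl by rewrite mulr_ge0.
have dl'2 : 4 * (2 / t * dl) ^+ 2 <= t.
  have -> : 4 * (2 / t * dl) ^+ 2 = 16 * dl ^+ 2 / t ^+ 2.
    by field; rewrite gt_eqF.
  by rewrite ler_pdivrMr ?exprn_gt0// -exprS.
have ep2 : 2 * (2 * dl) <= t by move: dlt; lra.
have [h1 h2] := weights_perturbation t0 dl'0 ep0 dK Bd UU UUh lam_sorted lamh_sorted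
  BU BhU gap hE dl'2 sSeps Sepst SepsT hSeps ep2 hrho.
split=> //; rewrite /beta_weighted -mulmxBr.
have -> : gm + (2 * b * (T / t) / t ^+ 2 + 4 / t ^+ 2 + 4 / t) * dl ^+ 2 =
    rho + (2 / t * dl) ^+ 2 + 2 / t * dl * (2 * dl).
  by rewrite /rho; field; rewrite gt_eqF.
exact: h2.
Qed.

End EstimationError.

(** * Population moments *)

Section EigenbasisBounds.
Variable R : realType.

Lemma eigenbasis_eigval n (A nu : 'M[R]_n) (lam : 'rV[R]_n) (i : 'I_n) :
  nu^T *m nu = 1%:M ->
  (forall i j : 'I_n, (i <= j)%N -> lam 0 j <= lam 0 i) ->
  A *m nu = nu *m diag_mx lam -> eigval A i.+1 = lam 0 i.
Proof.
move=> nunu lams Anu; rewrite /eigval (eigenbasis_eigvals nunu lams Anu)/=.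
by rewrite (nth_map i) ?size_enum_ord// nth_ord_enum.
Qed.

End EigenbasisBounds.

Section FeatureNoiseMoments.
Context d (T : measurableType d) (R : realType) (P : probability T R).
Variables (p K : nat) (X : T -> 'cV[R]_p) (eps : T -> 'cV[R]_(K.+1)).
Variables (Sxx : 'M[R]_p) (Seps : 'M[R]_(K.+1)) (s : R).
Let V w := col_mx (X w) (eps w).
Hypotheses (mV : random_vector V) (s0 : 0 < s) (Vs : subgaussian P V s).
Hypothesis X_moment : forall a b, ('E_P[(fun w => X w a 0 * X w b 0)%R] = (Sxx a b)%:E)%E.
Hypothesis indep : independent_pair P X eps.
Hypothesis eps_mean : forall k, ('E_P[(fun w => eps w k 0)%R] = 0)%E.
Hypothesis eps_cov : forall k l,
  covariance P (fun w => eps w k 0) (fun w => eps w l 0) = (Seps k l)%:E.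

Let mV_coord c : measurable_fun [set: T] (fun w => V w c 0).
Proof. exact: (measurableT_comp (@measurable_coord R _ c)). Qed.

Let iV_coord c : P.-integrable [set: T] (EFin \o (fun w => V w c 0)).
Proof.
have i2 := integrable_coordM mV s0 Vs c c.
have i1 : P.-integrable [set: T] (fun _ : T => 1%:E).
  exact: finite_measure_integrable_cst.
apply: (le_integrable measurableT _ _ (integrableD measurableT i1 i2)) => /=.
  exact/measurable_EFinP.
move=> w _ /=; rewrite lee_fin [leRHS]ger0_norm.
  by rewrite ler_norml; apply/andP; split; nra.
by rewrite addr_ge0// -expr2 sqr_ge0.
Qed.

Let cross a k : (\int[P]_w (X w a 0%R * eps w k 0%R)%R%:E = 0)%E.
Proof.
have XE w : X w a 0 = V w (lshift _ a) 0 by rewrite /V col_mxEu.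
have eE w : eps w k 0 = V w (rshift _ k) 0 by rewrite /V col_mxEd.
have mX : measurable_fun [set: T] (fun w => X w a 0).
  by under eq_fun do rewrite XE; exact: mV_coord.
have me : measurable_fun [set: T] (fun w => eps w k 0).
  by under eq_fun do rewrite eE; exact: mV_coord.
apply: (integral_mul_indep_mean0 mX me).
- move=> A C mA mC.
  have mA' := @measurable_coord R p a measurableT A mA.
  have mC' := @measurable_coord R K.+1 k measurableT C mC.
  by rewrite !setTI in mA' mC'; exact: (indep mA' mC').
- by rewrite (_ : (fun w => X w a 0) = fun w => V w (lshift _ a) 0)//; apply/funext.
- by rewrite (_ : (fun w => eps w k 0) = fun w => V w (rshift _ k) 0)//; apply/funext.
- by have := eps_mean k; rewrite unlock.
Qed.

Lemma second_moment_entries a b :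
  (\int[P]_w (V w a 0%R * V w b 0%R)%R%:E = (block_mx Sxx 0 0 Seps a b)%:E)%E.
Proof.
case: (split_ordP a) => a' ->; case: (split_ordP b) => b' ->.
- rewrite block_mxEul -X_moment unlock; apply: eq_integral => w _.
  by rewrite /V !col_mxEu.
- rewrite block_mxEur mxE -[RHS](cross a' b'); apply: eq_integral => w _.
  by rewrite /V col_mxEu col_mxEd.
- rewrite block_mxEdl mxE -[RHS](cross b' a'); apply: eq_integral => w _.
  by rewrite /V col_mxEu col_mxEd mulrC.
- rewrite block_mxEdr -eps_cov covariance.unlock !eps_mean unlock.
  by apply: eq_integral => w _; rewrite /V !col_mxEd !fctE /= !subr0.
Qed.

End FeatureNoiseMoments.

(** * Bound at a fixed sample size, and the theorem *)

Section FixedSampleSize.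
Context disp (Om : measurableType disp) (R : realType) (P : probability Om R).
Variables (N p K d : nat).
Variables (X : 'I_N -> Om -> 'cV[R]_p) (eps Y : 'I_N -> Om -> 'cV[R]_K.+1).
Variables (B : 'M[R]_(p, K.+1)) (Sxx : 'M[R]_p) (Seps nu : 'M[R]_(K.+1)).
Variables (nuhat : Om -> 'M[R]_(K.+1)) (Csub taumin taumax : R).
Let V i w := col_mx (X i w) (eps i w).
Hypothesis Y_def : forall i w k, Y i w k 0 = ((X i w)^T *m col k B) 0 0 + eps i w k 0.
Hypothesis X_moment : forall i a b,
  ('E_P[(fun w => X i w a 0 * X i w b 0)%R] = (Sxx a b)%:E)%E.
Hypothesis X_eps_indep : forall i, independent_pair P (X i) (eps i).
Hypothesis eps_mean : forall i k, ('E_P[(fun w => eps i w k 0)%R] = 0)%E.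
Hypothesis eps_cov : forall i k l,
  covariance P (fun w => eps i w k 0) (fun w => eps i w l 0) = (Seps k l)%:E.
Hypothesis nu_basis : eigenbasis (B^T *m B) nu.
Let Bh w := B_hat (fun i => X i w) (fun i => Y i w).
Hypothesis nuhat_basis : forall w, eigenbasis ((Bh w)^T *m Bh w) (nuhat w).
Hypothesis V_meas : forall i, random_vector (V i).
Hypothesis V_indep : mutually_independent P V.
Hypothesis V_subG : forall i, psi2_vnorm P (V i) = Csub%:E.
Hypothesis taumin_gt0 : 0 < taumin.
Hypothesis Sxx_eig : taumin <= eigval Sxx p /\ eigval Sxx 1 <= taumax.
Hypothesis Seps_eig : taumin <= eigval Seps K.+1 /\ eigval Seps 1 <= taumax.
Hypotheses (B_rank : \rank B = d) (d_lt : (d < K.+1)%N).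
Hypothesis B_eig : ((0 < d)%N -> taumin <= eigval (B^T *m B) d) /\
  eigval (B^T *m B) 1 <= taumax.
Let s := Csub + 1.
(* A bound on the norm of the matrix with diagonal blocks [Sxx^-1 B] and [z]. *)
Let kappa := Num.sqrt taumax / taumin + taumax / taumin.
Let dl := deviation 1 s (p + K.+1) N.
Let gm := deviation kappa s (K.+1 + 1) N.
Hypotheses (p0 : (0 < p)%N) (pKN : (3 * (p + K.+1) <= N)%N).
Hypotheses (dl1 : 4 * dl <= taumin) (dl2 : 16 * dl ^+ 2 <= taumin ^+ 3).

(** The event is where both [D] and [W^T D W] of [estimation_error] concentrate; it
    fails with probability at most [2 exp (- (p + K + 1)) + 2 exp (- (K + 2))]. *)
Lemma finite_sample_bound : exists E : set Om, [/\ measurable E,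
  (P (~` E) <= (4 * expR (- K%:R))%:E)%E &
  forall w, E w ->
    let x := fun i => X i w in
    let y := fun i => Y i w in
    let Qh := last_cols d (nuhat w) in
    let ws := weights (last_cols d nu) Seps in
    let wsh := weights Qh (Seps_hat x y) in
    [/\ Sxx_hat x \in unitmx, Qh^T *m Seps_hat x y *m Qh \in unitmx &
      norm2 (beta_weighted x y wsh - beta_weighted x y ws) <=
      perturbation_const taumin taumax *
        (gm + (2 * Num.sqrt taumax * (taumax / taumin) / taumin ^+ 2
               + 4 / taumin ^+ 2 + 4 / taumin) * dl ^+ 2)]].
Proof.
have N0 : (0 < N)%N by clear -pKN; lia.
pose i0 := Ordinal N0.
have pK0 : (0 < p + K.+1)%N by rewrite addnS.
have [s0 _] := psi2_subgaussian pK0 (V_meas i0) (V_subG i0).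
have Vs i : subgaussian P (V i) s.
  by have [] := psi2_subgaussian pK0 (V_meas i) (V_subG i).
pose M := block_mx Sxx 0 0 Seps.
have VM i := second_moment_entries (V_meas i) s0 (Vs i) (X_moment i) (X_eps_indep i)
  (eps_mean i) (eps_cov i).
have sSxx : Sxx^T = Sxx.
  apply/matrixP => a b; rewrite mxE; apply: EFin_inj; rewrite -!(X_moment i0).
  by congr expectation; apply/funext => w; rewrite mulrC.
have sSeps : Seps^T = Seps.
  apply/matrixP => a b; rewrite mxE; apply: EFin_inj; rewrite -!(eps_cov i0).
  exact: covarianceC.
have [Sxxt _] := eigval_bounds p0 sSxx taumin_gt0 Sxx_eig.1 Sxx_eig.2.
have [Sepst Sepsq] := eigval_bounds (ltn0Sn K) sSeps taumin_gt0 Seps_eig.1 Seps_eig.2.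
have T0 : 0 < taumax.
  have := Sepst (delta_mx ord0 0); have := Sepsq (delta_mx ord0 0).
  by rewrite -sqr_norm2 norm2_delta expr1n !mulr1; move: taumin_gt0; lra.
have SepsT : opbound Seps taumax.
  apply: sym_opbound => [||u]; [exact: ltW|exact: sSeps|].
  rewrite ger0_norm; first exact: Sepsq.
  by apply: le_trans (Sepst u); rewrite mulr_ge0 ?dotv_ge0// ltW.
have [nunu [lam lams Bnu]] := nu_basis.
have Bb : opbound B (Num.sqrt taumax).
  move=> u; rewrite -ler_sqr ?nnegrE ?mulr_ge0 ?sqrtr_ge0//.
  rewrite exprMn !sqr_norm2 (sqr_sqrtr (ltW T0)).
  apply: (gram_tail_le nunu Bnu (r := 0)) => // i _.
  apply: le_trans (B_eig.2); rewrite (eigenbasis_eigval ord0 nunu lams Bnu).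
  exact: lams.
have gap (i : 'I_K.+1) : (i < d)%N -> taumin <= lam 0 i.
  move=> id; have d'K : (d.-1 < K.+1)%N by exact: leq_ltn_trans (leq_pred d) d_lt.
  have d0 : (0 < d)%N by exact: leq_ltn_trans id.
  have := B_eig.1 d0; rewrite -[in eigval _ d](prednK d0).
  rewrite (eigenbasis_eigval (Ordinal d'K) nunu lams Bnu) => h; apply: le_trans h _.
  by apply: lams; rewrite /= -ltnS prednK.
pose z : 'cV[R]_K.+1 := delta_mx ord0 ord0 - weights (last_cols d nu) Seps.
have [_ zr] := weights_bounds d nunu taumin_gt0 sSeps Sepst SepsT.
have Tt0 : 0 < taumax / taumin by rewrite divr_gt0.
have k0 : 0 < kappa by rewrite addr_gt0// divr_gt0// sqrtr_gt0.
pose W := block_mx (invmx Sxx *m B) 0 0 z.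
have Wk : opbound W^T^T kappa.
  rewrite trmxK; apply: opbound_block_diag; rewrite ?divr_ge0 ?sqrtr_ge0// ?ltW//.
    rewrite mulrC; apply: opboundM => //; first by rewrite invr_ge0 ltW.
    exact: coercive_invmx taumin_gt0 Sxxt.
  move=> u; rewrite {1}[u]mx11_scalar mul_mx_scalar norm2Z mulrC.
  by apply: ler_pM => //; exact: entry_le_norm2.
have id1 : opbound (1%:M^T : 'M[R]_(p + K.+1)) 1.
  by move=> u; rewrite trmx1 mul1mx mul1r.
have m2 : (3 * (K.+1 + 1) <= N)%N by clear -pKN p0; lia.
have [E1 [mE1 PE1 hE1]] := sample_moment_concentration V_meas s0 V_indep Vs VM pK0 pKN
  ltr01 id1.
have [E2 [mE2 PE2 hE2]] := sample_moment_concentration V_meas s0 V_indep Vs VM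
  (leq_addl K.+1 1) m2 k0 Wk.
exists (E1 `&` E2); split; first exact: measurableI.
  rewrite setCI; apply: le_trans (measureU2 _ _ _) _ => /=; try exact: measurableC.
  apply: le_trans (leeD PE1 PE2) _; rewrite -EFinD lee_fin.
  have -> : 4 = 2 + 2 :> R by ring.
  rewrite [leRHS]mulrDl; apply: lerD; rewrite ler_wpM2l// ler_expR lerN2 ler_nat.
    by rewrite addnS leqW// leq_addl.
  by rewrite addn1 leqW.
move=> w [E1w E2w] x y Qh ws wsh.
have [nhnh [lamh lamhs Bhn]] := nuhat_basis w.
have sM : M^T = M by rewrite tr_block_mx !trmx0 sSxx sSeps.
have sSM : (sample_moment V w - M)^T = sample_moment V w - M.
  by rewrite linearB/= sM sample_moment_tr.
have dl0 : 0 <= dl by exact: deviation_ge0.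
have gm0 : 0 <= gm by exact: deviation_ge0.
have Ddl : opbound (sample_moment V w - M) dl.
  apply: sym_opbound => // u.
  by have := hE1 w E1w u; rewrite mul1mx trmx1 mulmx1.
have Dgm : opbound (W^T *m (sample_moment V w - M) *m W) gm.
  apply: sym_opbound => // [|u]; first by rewrite !trmx_mul trmxK sSM mulmxA.
  by have := hE2 w E2w u; rewrite trmxK.
exact: (estimation_error (fun i k => Y_def i w k) taumin_gt0 (sqrtr_ge0 _) dl0 dl1 dl2
  sSxx Sxxt sSeps Sepst SepsT Bb B_rank d_lt nunu nhnh lams lamhs Bnu Bhn gap Ddl Dgm).
Qed.

End FixedSampleSize.

Theorem theorem1 (R : realType)
  (* one probability space and one set of dimensions for each sample size N *)
  (disp : nat -> measure_display)
  (Om : forall N : nat, measurableType (disp N))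
  (P : forall N : nat, probability (Om N) R)
  (p K d : nat -> nat)
  (* features, noises, responses *)
  (X : forall N : nat, 'I_N -> Om N -> 'cV[R]_(p N))
  (eps : forall N : nat, 'I_N -> Om N -> 'cV[R]_(K N).+1)
  (Y : forall N : nat, 'I_N -> Om N -> 'cV[R]_(K N).+1)
  (* population parameters; column k of B N is beta^(k) *)
  (B : forall N : nat, 'M[R]_(p N, (K N).+1))
  (Sxx : forall N : nat, 'M[R]_(p N))
  (Seps : forall N : nat, 'M[R]_((K N).+1))
  (* eigenvectors of B^T B and of its estimate *)
  (nu : forall N : nat, 'M[R]_((K N).+1))
  (nuhat : forall N : nat, Om N -> 'M[R]_((K N).+1))
  (Csub taumin taumax : R)
  (* the model *)
  (Y_def : forall (N : nat) (i : 'I_N) (w : Om N) (k : 'I_(K N).+1),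
     Y N i w k 0 = ((X N i w)^T *m col k (B N)) 0 0 + eps N i w k 0)
  (X_moment : forall (N : nat) (i : 'I_N) (a b : 'I_(p N)),
     ('E_(P N)[(fun w => X N i w a 0 * X N i w b 0)%R] = (Sxx N a b)%:E)%E)
  (X_eps_indep : forall (N : nat) (i : 'I_N),
     independent_pair (P N) (X N i) (eps N i))
  (eps_mean : forall (N : nat) (i : 'I_N) (k : 'I_(K N).+1),
     ('E_(P N)[(fun w => eps N i w k 0)%R] = 0)%E)
  (eps_cov : forall (N : nat) (i : 'I_N) (k l : 'I_(K N).+1),
     covariance (P N) (fun w => eps N i w k 0) (fun w => eps N i w l 0)
     = (Seps N k l)%:E)
  (nu_basis : forall N : nat, eigenbasis ((B N)^T *m B N) (nu N))
  (nu_sign : forall N : nat, sign_normalized (nu N))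
  (nuhat_basis : forall (N : nat) (w : Om N),
     let Bh := B_hat (fun i => X N i w) (fun i => Y N i w) in
     eigenbasis (Bh^T *m Bh) (nuhat N w))
  (* (1) *)
  (V_meas : forall (N : nat) (i : 'I_N),
     random_vector (fun w => col_mx (X N i w) (eps N i w)))
  (V_indep : forall N : nat,
     mutually_independent (P N) (fun (i : 'I_N) w => col_mx (X N i w) (eps N i w)))
  (V_id : forall N : nat,
     identically_distributed (P N)
       (fun (i : 'I_N) w => col_mx (X N i w) (eps N i w)))
  (V_subG : forall (N : nat) (i : 'I_N),
     psi2_vnorm (P N) (fun w => col_mx (X N i w) (eps N i w)) = Csub%:E)
  (* (2) *)
  (taumin_gt0 : 0 < taumin)
  (Sxx_eig : \forall N \near \oo,
     taumin <= eigval (Sxx N) (p N) /\ eigval (Sxx N) 1 <= taumax)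
  (Seps_eig : \forall N \near \oo,
     taumin <= eigval (Seps N) (K N).+1 /\ eigval (Seps N) 1 <= taumax)
  (* (3) *)
  (B_rank : forall N : nat, \rank (B N) = d N)
  (d_lt : forall N : nat, (d N < (K N).+1)%N)
  (B_eig : \forall N \near \oo,
     ((0 < d N)%N -> taumin <= eigval ((B N)^T *m B N) (d N)) /\
     eigval ((B N)^T *m B N) 1 <= taumax)
  (* (4) *)
  (K_infty : K @ \oo --> \oo)
  (p_infty : p @ \oo --> \oo)
  (K_over_p : ((K N)%:R / (p N)%:R : R) @[N --> \oo] --> (0 : R))
  (p_over_N : ((p N)%:R / N%:R : R) @[N --> \oo] --> (0 : R)) :
  exists C1 C2 : R, [/\ 0 < C1, 0 < C2 &
    exists N0 : nat, forall N : nat, (N0 < N)%N ->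
      exists E : set (Om N),
        [/\ measurable E,
            ((1 - C2 * expR (- (K N)%:R))%:E <= P N E)%E &
            forall w : Om N, E w ->
              let x := fun i : 'I_N => X N i w in
              let y := fun i : 'I_N => Y N i w in
              let Theta := last_cols (d N) (nu N) in
              let Thetahat := last_cols (d N) (nuhat N w) in
              let wstar := weights Theta (Seps N) in
              let wstarhat := weights Thetahat (Seps_hat x y) in
              [/\ Sxx_hat x \in unitmx,
                  Thetahat^T *m Seps_hat x y *m Thetahat \in unitmx &
                  norm2 (beta_weighted x y wstarhat - beta_weighted x y wstar)
                  <= C1 * (Num.sqrt ((K N + d N)%N%:R / N%:R)
                           + (p N)%:R / N%:R)]]].
Proof.
pose s := Csub + 1.
pose kappa := Num.sqrt taumax / taumin + taumax / taumin.
pose c := 2 * Num.sqrt taumax * (taumax / taumin) / taumin ^+ 2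
  + 4 / taumin ^+ 2 + 4 / taumin.
have [e0 e00 small] := small_deviation s taumin_gt0.
have [C1 C10 rate] := rate_bound (perturbation_const taumin taumax) c kappa s.
have [N1 _ dims] := dimensions_eventually e00 K_infty p_infty K_over_p p_over_N.
have [N2 _ SxxE] := Sxx_eig; have [N3 _ SepsE] := Seps_eig; have [N4 _ BE] := B_eig.
exists C1, 4; split=> //; exists (maxn (maxn N1 N2) (maxn N3 N4)) => N.
rewrite !gtn_max => /andP[/andP[n1 n2] /andP[n3 n4]].
have N0 : (0 < N)%N by exact: leq_ltn_trans n1.
have [K0 p0 pK pN] := dims N (ltnW n1).
have [pKN dl1 dl2] := small N (p N) (K N) N0 pK pN.
have [E [mE PE HE]] := finite_sample_bound (@Y_def N) (@X_moment N) (@X_eps_indep N)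
  (@eps_mean N) (@eps_cov N) (nu_basis N) (@nuhat_basis N) (@V_meas N) (@V_indep N)
  (@V_subG N) taumin_gt0 (SxxE N (ltnW n2)) (SepsE N (ltnW n3)) (B_rank N) (d_lt N)
  (BE N (ltnW n4)) p0 pKN dl1 dl2.
exists E; split; first exact: mE.
  rewrite -[E in leRHS]setCK probability_setC; last exact: measurableC.
  by rewrite EFinB leeB.
move=> w Ew x y Theta Thetahat wstar wstarhat.
have [u1 u2 bd] := HE w Ew; split; [exact: u1|exact: u2|].
exact: le_trans bd (rate N (p N) (K N) (d N) K0 pK).
Qed.
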